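(* Let $(M^n,g)$ be a Riemannian manifold of dimension $n\geq 3$, and let $Y$ be the Yamabe operator of $(M,g)$, $$Yf=\Delta f+\frac{n-2}{4(n-1)}\,\mathrm{Sc}\,f .$$ For any function $f\in C^\infty(M)$ and $\sigma_a$ a conformal Killing tensor (of order $1$) on $M$, if $$Y\bigl(\sigma^a\nabla_a+A\,\nabla_a\sigma^a\bigr)f=\bigl(\sigma^a\nabla_a+B\,\nabla_a\sigma^a\bigr)Yf,$$ where $A,B$ are constants, then $$A=\frac{n-2}{2n}\qquad\text{and}\qquad B=\frac{n+2}{2n}.$$
   Context: Here $\nabla$ is the connection associated to the Riemannian metric $g=g_{ab}$, indices are raised and lowered with $g$, and repeated indices are summed (Einstein convention). In the operators above, $\nabla_a\sigma^a$ denotes multiplication by the function $\nabla_a\sigma^a$. $\mathrm{Sc}$ is the scalar curvature of $g$. $\Delta$ is the Bochner Laplacian on functions, i.e. the negative of the Laplace-Beltrami operator: $\Delta f=-\nabla^a\nabla_a f$. A conformal Killing tensor of order $1$ is a $1$-form $\sigma_a$ on $M$ such that $$\tfrac12(\nabla_a\sigma_b+\nabla_b\sigma_a)-\tfrac1n(\nabla^c\sigma_c)\,g_{ab}=0 .$$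
   Formalization: The identity is assumed for every f in C^∞(M) (for f = 0 alone the claim fails), and the divergence ∇_aσ^a is assumed not locally constant; for σ Killing (e.g. σ = 0) or homothetic, the constants A, B are not determined. *)

(* Defs.v *)
From HB Require Import structures.
From mathcomp Require Import all_boot all_order all_algebra.
From mathcomp Require Import all_classical all_reals all_analysis.
Import Order.TTheory GRing.Theory Num.Theory.
Import numFieldNormedType.Exports.

Set Implicit Arguments.
Unset Strict Implicit.
Unset Printing Implicit Defensive.

Local Open Scope classical_set_scope.
Local Open Scope ring_scope.

(* Riemannian geometry in classical index notation. A tensor field is given by
   its component functions in every chart, subject to the tensor transformation
   law on overlaps; covariant derivatives, curvature and differential operators
   are given by their coordinate expressions. Component functions are total on
   R^n: their values outside the coordinate image of the chart are irrelevant. *)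

Section EuclideanCalculus.
Context {R : realType} {n : nat}.
Implicit Types (U : set 'rV[R]_n) (f : 'rV[R]_n -> R).

Definition partial (a : 'I_n) f : 'rV[R]_n -> R :=
  fun x => 'D_(delta_mx 0 a) f x.

(* [U] is meant to be open. Continuity of [f] itself is only required at
   [k = 0]; for [k > 0] it follows from that of the partial derivatives. *)
Fixpoint Ck_on (k : nat) U f : Prop :=
  if k is k'.+1 then
    forall a : 'I_n, (forall x, U x -> derivable f x (delta_mx 0 a)) /\
                     Ck_on k' U (partial a f)
  else forall x, U x -> {for x, continuous f}.

Definition smooth_on U f : Prop :=
  forall k, Ck_on k U f.

End EuclideanCalculus.

Section Manifold.
Context (R : realType) (n : nat) (M : topologicalType).

(* The atlas need not be maximal; [param i] is the inverse of the chart
   [coord i : dom i -> coord i @` dom i]. *)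
Record smooth_manifold := SmoothManifold {
  chart : Type;
  dom : chart -> set M;
  coord : chart -> M -> 'rV[R]_n;
  param : chart -> 'rV[R]_n -> M;
  manifold_hausdorff : hausdorff_space M;
  manifold_second_countable : @second_countable M;
  dom_open : forall i, open (dom i);
  img_open : forall i, open (coord i @` dom i);
  dom_cover : forall p, exists i, dom i p;
  coordK : forall i p, dom i p -> param i (coord i p) = p;
  coord_continuous : forall i p, dom i p -> {for p, continuous (coord i)};
  param_continuous : forall i x, (coord i @` dom i) x ->
    {for x, continuous (param i)};
  transition_smooth : forall i j (c : 'I_n),
    smooth_on (coord i @` (dom i `&` dom j))
              (fun x => coord j (param i x) 0 c)
}.

Variable X : smooth_manifold.
Implicit Types i j : chart X.

Definition img i : set 'rV[R]_n := coord i @` dom i.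

Definition overlap i j : set 'rV[R]_n := coord i @` (dom i `&` dom j).

Definition transition i j (x : 'rV[R]_n) : 'rV[R]_n := coord j (param i x).

(* Entry (a, c) is the partial derivative d y^c / d x^a of y = transition x. *)
Definition transition_jac i j (x : 'rV[R]_n) : 'M[R]_n :=
  \matrix_(a, c) partial a (fun z => transition i j z 0 c) x.

Definition local_rep i (f : M -> R) : 'rV[R]_n -> R := fun x => f (param i x).

Definition smooth_function (f : M -> R) : Prop :=
  forall i, smooth_on (img i) (local_rep i f).

Record riemannian_metric := RiemannianMetric {
  metric : chart X -> 'rV[R]_n -> 'M[R]_n;
  metric_smooth : forall i (a b : 'I_n),
    smooth_on (img i) (fun x => metric i x a b);
  metric_sym : forall i x, img i x -> (metric i x)^T = metric i x;
  metric_posdef : forall i x (v : 'rV[R]_n), img i x -> v != 0 ->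
    0 < (v *m metric i x *m v^T) 0 0;
  metric_change : forall i j x, overlap i j x ->
    metric i x = transition_jac i j x *m metric j (transition i j x)
                   *m (transition_jac i j x)^T
}.

Record one_form := OneForm {
  form : chart X -> 'rV[R]_n -> 'rV[R]_n;
  form_smooth : forall i (a : 'I_n),
    smooth_on (img i) (fun x => form i x 0 a);
  form_change : forall i j x, overlap i j x ->
    form i x = form j (transition i j x) *m (transition_jac i j x)^T
}.

End Manifold.

Section LocalExpressions.
Context {R : realType} {n : nat}.
Variable g : 'rV[R]_n -> 'M[R]_n.
Implicit Types (s : 'rV[R]_n -> 'rV[R]_n) (f : 'rV[R]_n -> R) (x : 'rV[R]_n).

Definition ginv x : 'M[R]_n := invmx (g x).

(* Christoffel symbol Gamma^c_{ab} of the Levi-Civita connection. *)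
Definition christoffel (c a b : 'I_n) x : R :=
  2^-1 * \sum_d ginv x c d *
    (partial a (fun y => g y d b) x + partial b (fun y => g y d a) x
     - partial d (fun y => g y a b) x).

(* nabla_a s_b for a 1-form s *)
Definition nabla s (a b : 'I_n) x : R :=
  partial a (fun y => s y 0 b) x - \sum_c christoffel c a b x * s x 0 c.

(* nabla_a s^a = g^{ab} nabla_a s_b *)
Definition divergence s x : R := \sum_a \sum_b ginv x a b * nabla s a b x.

Definition raise s x (a : 'I_n) : R := \sum_b ginv x a b * s x 0 b.

Definition differential f x : 'rV[R]_n := \row_a partial a f x.

(* Delta f = - nabla^a nabla_a f *)
Definition bochner_laplacian f x : R := - divergence (differential f) x.

(* R_{ab} = R^c_{acb}, with the sign making round spheres positively curved. *)
Definition ricci (a b : 'I_n) x : R :=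
  \sum_c (partial c (christoffel c a b) x - partial b (christoffel c a c) x
          + \sum_d (christoffel c c d x * christoffel d a b x
                    - christoffel c b d x * christoffel d a c x)).

Definition scalar_curvature x : R := \sum_a \sum_b ginv x a b * ricci a b x.

Definition yamabe f x : R :=
  bochner_laplacian f x
  + (n%:R - 2) / (4 * (n%:R - 1)) * scalar_curvature x * f x.

(* (s^a nabla_a + A nabla_a s^a) f *)
Definition first_order_op s (A : R) f x : R :=
  \sum_a raise s x a * partial a f x + A * divergence s x * f x.

End LocalExpressions.

Section ConformalKilling.
Context (R : realType) (n : nat) (M : topologicalType).
Variables (X : smooth_manifold R n M) (g : riemannian_metric X).

Definition conformal_killing (s : one_form X) : Prop :=
  forall (i : chart X) x, img i x -> forall a b : 'I_n,
    2^-1 * (nabla (metric g i) (form s i) a b x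
            + nabla (metric g i) (form s i) b a x)
    - n%:R^-1 * divergence (metric g i) (form s i) x * metric g i x a b = 0.

(* nabla_a s^a is not locally constant: its differential is nonzero somewhere.
   This fails e.g. for Killing (divergence 0) and homothetic (constant
   divergence) fields. *)
Definition divergence_not_locally_constant (s : one_form X) : Prop :=
  exists (i : chart X) x,
    img i x /\ differential (divergence (metric g i) (form s i)) x != 0.

(* The two sides of Y (s^a nabla_a + A nabla_a s^a) f =
   (s^a nabla_a + B nabla_a s^a) Y f are compared in every chart. *)
Definition yamabe_intertwining (s : one_form X) (A B : R) (f : M -> R) : Prop :=
  forall (i : chart X) x, img i x ->
    yamabe (metric g i)
      (first_order_op (metric g i) (form s i) A (local_rep i f)) x
    = first_order_op (metric g i) (form s i) B
        (yamabe (metric g i) (local_rep i f)) x.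

End ConformalKilling.

(* Main.v *)
From HB Require Import structures.
From mathcomp Require Import all_boot all_order all_algebra.
From mathcomp Require Import all_classical all_reals all_analysis.
From mathcomp Require Import ring lra.
(* [Defs] comes last so that [coord] denotes the chart map of a manifold. *)
Require Import Defs.
Import Order.TTheory GRing.Theory Num.Theory.
Import numFieldNormedType.Exports.
Set Implicit Arguments.
Unset Strict Implicit.
Unset Printing Implicit Defensive.
Local Open Scope classical_set_scope.
Local Open Scope ring_scope.

(** Fix a chart and write H for the inverse metric, S for the vector field with
    components s^a, and phi for its divergence. Let lambda_a be the derivative
    of log sqrt (det g) along x^a; it is a closed 1-form. Contracting the
    Christoffel symbols gives
      - Delta f = H^{ab} d_a d_b f + h^c d_c f,   h^c = d_a H^{ac} + H^{ac} lambda_a,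
      phi = d_a s^a + lambda_a s^a,
    and the conformal Killing equation says that the Lie derivative of H along
    S is - psi H, where psi = (2/n) phi. Differentiating these identities, and
    using that lambda is closed, yields the first order part of the commutator
    of S with the Laplacian, without any curvature tensor:
      s^a d_a h^c + Delta (s^c) = H^{ac} d_a (phi - psi) - psi h^c
    ([laplace_commutator]; here Delta acts on the component s^c as on a function).

    The intertwining relation is then evaluated at a point x0 on functions of
    y^c, the c-th coordinate minus its value at x0. The scalar curvature drops
    out, because these functions vanish at x0.
    - The square of y^c gives (B - A - 2/n) phi H^{cc} = 0 ([quadratic_test]).
    - The function y^c gives
      (2A - 1 + 2/n) H^{ac} d_a phi = (B - A - 2/n) phi h^c ([linear_test]).
    Since phi is not locally constant, there are a point where phi does not
    vanish, whence B = A + 2/n, and a point where d phi does not vanish, whence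
    2A = 1 - 2/n.

    The relation is only assumed for functions on the whole of M, so the
    coordinate functions are multiplied by a smooth cutoff supported in the
    chart ([smooth_cutoff]) and extended by zero; the extension is smooth in
    every chart because compact sets are closed in the Hausdorff space M
    ([extend_by_zero]). Since [Ck_on] speaks of partial derivatives only, the
    calculus this rests on is derived from them: continuous partial derivatives
    imply differentiability ([differentiable_of_C1]), hence the product and
    chain rules for [Ck_on], and second partial derivatives commute
    ([partial_comm]). *)

(** * Calculus of partial derivatives *)

Section PartialDerivatives.
Context {R : realType} {n : nat}.
Implicit Types (U V : set 'rV[R]_n) (f g : 'rV[R]_n -> R) (a b : 'I_n).
Local Notation "''e_' a" := (delta_mx 0 a : 'rV[R]_n) (at level 8, a at level 2).

Lemma line_is_derive f (y v : 'rV[R]_n) (t : R) :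
  derivable f (y + t *: v) v ->
  is_derive t 1 (fun s : R => f (y + s *: v)) ('D_v f (y + t *: v)).
Proof.
have E : (fun h : R =>
      h^-1 *: (((fun s : R => f (y + s *: v)) \o shift t) (h *: 1) - f (y + t *: v))) =
  (fun h : R => h^-1 *: ((f \o shift (y + t *: v)) (h *: v) - f (y + t *: v))).
  apply/funext => h; rewrite /= /shift /=; congr (_ *: (f _ - _)).
  by rewrite [h *: 1]mulr1 scalerDl addrCA.
by move=> df; split; rewrite /derivable /derive /= E.
Qed.

Lemma shift_is_derive f (x v w : 'rV[R]_n) :
  derivable f (x + w) v -> is_derive x v (fun y => f (y + w)) ('D_v f (x + w)).
Proof.
have E : (fun h : R => h^-1 *: (((fun y => f (y + w)) \o shift x) (h *: v) - f (x + w))) =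
  (fun h : R => h^-1 *: ((f \o shift (x + w)) (h *: v) - f (x + w))).
  by apply/funext => h; rewrite /= /shift /= addrA.
by move=> df; split; rewrite /derivable /derive /= E.
Qed.

Lemma partial_MVT_ge0 f a (y : 'rV[R]_n) (c : R) : 0 <= c ->
  (forall t, 0 <= t <= c -> derivable f (y + t *: 'e_a) 'e_a) ->
  exists2 t, 0 <= t <= c & f (y + c *: 'e_a) - f y = c * partial a f (y + t *: 'e_a).
Proof.
move=> c0 df.
pose phi (s : R) := f (y + s *: 'e_a).
have dphi t : 0 <= t <= c -> is_derive t 1 phi (partial a f (y + t *: 'e_a)).
  by move=> /df; exact: line_is_derive.
have [||t] := @MVT_segment R phi (fun t => partial a f (y + t *: 'e_a)) 0 c c0.
- by move=> t; rewrite in_itv /= => /andP[t0 t1]; apply: dphi; rewrite !ltW.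
- apply: derivable_within_continuous => t; rewrite in_itv /= => tc.
  by have [] := dphi _ tc.
- rewrite in_itv /= /phi scale0r addr0 subr0 => tc ->.
  by exists t => //; rewrite mulrC.
Qed.

Lemma partial_MVT f a (y : 'rV[R]_n) (c : R) :
  (forall t, `|t| <= `|c| -> derivable f (y + t *: 'e_a) 'e_a) ->
  exists2 t, `|t| <= `|c| & f (y + c *: 'e_a) - f y = c * partial a f (y + t *: 'e_a).
Proof.
move=> df; have [c0|/ltW c0] := leP 0 c.
  have [t /andP[t0 tc]|t /andP[t0 tc] E] := @partial_MVT_ge0 f a y c c0.
    by apply: df; rewrite !ger0_norm.
  by exists t => //; rewrite !ger0_norm.
have [||t /andP[t0 tc] E] := @partial_MVT_ge0 f a (y + c *: 'e_a) (- c).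
- by rewrite oppr_ge0.
- move=> t /andP[t0 tc]; rewrite -addrA -scalerDl; apply: df.
  by rewrite (ler0_norm c0) ler_norml; apply/andP; split; lra.
exists (c + t); first by rewrite (ler0_norm c0) ler_norml; apply/andP; split; lra.
move: E; rewrite -!addrA -!scalerDl subrr scale0r addr0 mulNr => E.
by rewrite -opprB E opprK.
Qed.

Lemma norm_coord_le (h : 'rV[R]_n) a : `|h 0 a| <= `|h|.
Proof.
rewrite [leRHS]/Num.norm /= mx_normrE.
exact: (le_bigmax 0 (fun ij : 'I_1 * 'I_n => `|h ij.1 ij.2|) (0, a)).
Qed.

Lemma norm_rV_le (h : 'rV[R]_n) (c : R) : 0 <= c ->
  (forall a, `|h 0 a| <= c) -> `|h| <= c.
Proof.
move=> c0 hc; rewrite [leLHS]/Num.norm /= mx_normrE.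
by apply/bigmax_leP; split => // -[i j] _ /=; rewrite ord1.
Qed.

(** The vector agreeing with [h] in its first [k] coordinates and zero in the
    others: the vertices of a path from 0 to [h] parallel to the axes. *)
Definition partial_path (h : 'rV[R]_n) (k : nat) : 'rV[R]_n :=
  \row_j (if (j < k)%N then h 0 j else 0).

Lemma partial_path0 h : partial_path h 0 = 0.
Proof. by apply/rowP => j; rewrite !mxE. Qed.

Lemma partial_pathn h : partial_path h n = h.
Proof. by apply/rowP => j; rewrite !mxE ltn_ord. Qed.

Lemma partial_pathS h (k : 'I_n) :
  partial_path h k.+1 = partial_path h k + h 0 k *: 'e_k.
Proof.
apply/rowP => j; rewrite !mxE eqxx /= ltnS leq_eqVlt.
have [->|jk] := eqVneq j k; first by rewrite eqxx /= ltnn mulr1 add0r.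
by rewrite (negPf (jk : (j : nat) != k)) mulr0 addr0.
Qed.

Lemma partial_path_le h k t a : `|t| <= `|h| ->
  `|partial_path h k + t *: 'e_a| <= `|h| + `|h|.
Proof.
move=> th; apply: le_trans (ler_normD _ _) _; apply: lerD.
  apply: norm_rV_le => // j; rewrite mxE; case: ifP => _; first exact: norm_coord_le.
  by rewrite normr0.
apply: norm_rV_le => // j; rewrite !mxE eqxx /=.
by case: (j == a); rewrite ?mulr1 // mulr0 normr0.
Qed.

(** The candidate for the differential of [f] at [x]. *)
Definition gradient_form f (x h : 'rV[R]_n) : R := \sum_a h 0 a * partial a f x.

Lemma gradient_form_linear f x : linear (gradient_form f x).
Proof.
move=> k u v; rewrite /gradient_form.
have -> : k *: (\sum_a u 0 a * partial a f x) = k * (\sum_a u 0 a * partial a f x) by [].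
rewrite mulr_sumr -big_split /=.
by apply: eq_bigr => a _; rewrite !mxE mulrDl mulrA.
Qed.

HB.instance Definition _ f x :=
  GRing.isLinear.Build R 'rV[R]_n R _ (gradient_form f x) (@gradient_form_linear f x).

Lemma gradient_form_continuous f x : continuous (gradient_form f x).
Proof.
apply: bounded_linear_continuous; apply/linear_boundedP.
exists (\sum_a `|partial a f x|); split => [|M ML h].
  by apply: ger0_real; apply: sumr_ge0.
apply: le_trans (ler_norm_sum _ _ _) _.
apply: (@le_trans _ _ (\sum_a `|h| * `|partial a f x|)).
  by apply: ler_sum => a _; rewrite normrM ler_wpM2r // norm_coord_le.
by rewrite -mulr_sumr mulrC ler_wpM2r // ltW.
Qed.

Lemma C1_estimate U f x (eps : R) : open U -> U x -> 0 < eps ->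
  (forall a y, U y -> derivable f y 'e_a) ->
  (forall a, {for x, continuous (partial a f)}) ->
  \forall h \near (0 : 'rV[R]_n), `|f (h + x) - f x - gradient_form f x h| <= eps * `|h|.
Proof.
move=> oU Ux e0 df cf.
pose e1 := eps / n.+1%:R.
have e10 : 0 < e1 by rewrite divr_gt0.
have nU : \forall y \near x, U y /\ forall a, `|partial a f x - partial a f y| < e1.
  near=> y; split; first by near: y; exact: open_nbhs_nbhs.
  near: y.
  by apply: filter_forall => a; have /cvgrPdist_lt := cf a; exact.
have [d /= d0 Bd] := (nbhs_ballP _ _).1 nU.
have d20 : 0 < d / 2 by rewrite divr_gt0.
near=> h.
have hd : `|h| < d / 2.
  near: h; apply/nbhs_ballP; exists (d / 2) => //= y.
  by rewrite -ball_normE /= sub0r normrN.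
have inB k t a : `|t| <= `|h| -> ball x d (x + (partial_path h k + t *: 'e_a)).
  move=> th; rewrite -ball_normE /= opprD addNKr normrN.
  by apply: le_lt_trans (partial_path_le _ _ th) _; lra.
(* Follow the axis-parallel path from x to x + h, one mean value per edge. *)
have telesc : f (h + x) - f x =
    \sum_(k < n) (f (x + partial_path h k.+1)
    - f (x + partial_path h k)).
  rewrite -(big_mkord xpredT (fun k => f (x + partial_path h k.+1) - f (x + partial_path h k))).
  by rewrite (telescope_sumr (fun k => f (x + partial_path h k))) //
    partial_path0 addr0 partial_pathn [h + x]addrC.
rewrite telesc /gradient_form -sumrB.
apply: le_trans (ler_norm_sum _ _ _) _.
apply: (@le_trans _ _ (\sum_(k < n) e1 * `|h|)).
  apply: ler_sum => k _.
  have [|t th E] := @partial_MVT f k (x + partial_path h k) (h 0 k).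
    move=> t th; apply: df; rewrite -addrA; apply: (Bd _ _).1; apply: inB.
    exact: le_trans th (norm_coord_le _ _).
  rewrite partial_pathS addrA E -mulrBr normrM mulrC ler_pM //; last exact: norm_coord_le.
  rewrite distrC ltW // -addrA; apply: (Bd _ _).2; apply: inB.
  exact: le_trans th (norm_coord_le _ _).
rewrite sumr_const card_ord -mulr_natr mulrAC ler_wpM2r // /e1.
rewrite -mulrA ler_piMr ?(ltW e0) // mulrC ler_pdivrMr // mul1r ler_nat //.
Unshelve. all: by end_near. Qed.

Lemma differentiable_of_C1 U f x : open U -> U x ->
  (forall a y, U y -> derivable f y 'e_a) ->
  (forall a, {for x, continuous (partial a f)}) ->
  differentiable f x.
Proof.
move=> oU Ux df cf; apply/diffP => /=.
pose L : {linear 'rV[R]_n -> R} := gradient_form f x.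
apply: (@getPex _ (fun (df : {linear 'rV[R]_n -> R}) => continuous df /\
  forall y, f y = f (lim (nbhs x)) + df (y - lim (nbhs x))
                  +o_(y \near x) (y - lim (nbhs x)))).
exists L; split; first exact: gradient_form_continuous.
apply: eqaddoEx; rewrite lim_id //.
suff /eqaddoP E : forall eps, 0 < eps -> \forall y \near x,
    `|(f - (fun y => f x + L (y - x))) y| <= eps * `|y - x|.
  by move=> y; rewrite {1}E.
move=> e e0; have := C1_estimate oU Ux e0 df cf.
rewrite (near_shift x) sub0r; apply: filterS => y /=.
rewrite /shift /= subrK; congr (`| _ | <= _).
by rewrite /GRing.add /= /GRing.opp /= opprD addrA.
Qed.

Lemma partial_eq_on U f g a x : open U -> (forall y, U y -> f y = g y) ->
  U x -> partial a f x = partial a g x.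
Proof.
move=> oU fg Ux; apply: near_eq_derive.
by apply: filterS (open_nbhs_nbhs (conj oU Ux)).
Qed.

Lemma Ck_on_sub k U V f : V `<=` U -> Ck_on k U f -> Ck_on k V f.
Proof.
elim: k f => [|k IH] f VU /=; first by move=> H x /VU; exact: H.
by move=> H a; have [H1 H2] := H a; split=> [x /VU|]; [exact: H1|exact: IH].
Qed.

Lemma Ck_on_setU k U V f : Ck_on k U f -> Ck_on k V f -> Ck_on k (U `|` V) f.
Proof.
elim: k f => [|k IH] f /=; first by move=> HU HV x [/HU|/HV].
move=> HU HV a; have [HU1 HU2] := HU a; have [HV1 HV2] := HV a; split.
  by move=> x [/HU1|/HV1].
exact: IH.
Qed.

Lemma Ck_on_eq k U f g : open U -> (forall y, U y -> f y = g y) ->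
  Ck_on k U f -> Ck_on k U g.
Proof.
move=> oU; elim: k f g => [|k IH] f g fg /=.
  move=> H x Ux; suff : f y @[y --> x] --> f x -> g y @[y --> x] --> g x by apply; exact: H.
  rewrite -(fg _ Ux); apply: cvg_trans; apply: (@near_eq_cvg _ _ (nbhs x)).
  exact: filterS fg (open_nbhs_nbhs (conj oU Ux)).
move=> H a; have [H1 H2] := H a; split.
  move=> x Ux; apply: near_eq_derivable (H1 x Ux).
  by apply: filterS (open_nbhs_nbhs (conj oU Ux)).
by apply: IH H2 => y Uy; exact: (partial_eq_on _ oU fg).
Qed.

(** Continuous partial derivatives give differentiability, hence continuity. *)
Lemma Ck_on_differentiable k U f x : open U -> Ck_on k.+1 U f -> U x ->
  differentiable f x.
Proof.
elim: k f x => [|k IH] f x oU H Ux.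
  by apply: (differentiable_of_C1 oU Ux) => [a y Uy|a]; have [H1 H2] := H a; auto.
apply: (differentiable_of_C1 oU Ux) => [a y Uy|a]; have [H1 H2] := H a; auto.
by apply: differentiable_continuous; exact: IH.
Qed.

Lemma Ck_onW k U f : open U -> Ck_on k.+1 U f -> Ck_on k U f.
Proof.
move=> oU; elim: k f => [|k IH] f H.
  by move=> x Ux; apply: differentiable_continuous; exact: Ck_on_differentiable H Ux.
by move=> a; have [H1 H2] := H a; split => //; exact: IH.
Qed.

Lemma partial_cst a (c : R) : partial a (fun=> c) = (fun=> 0).
Proof. by apply/funext => x; rewrite /partial derive_cst. Qed.

Lemma Ck_on_cst k U (c : R) : Ck_on k U (fun=> c).
Proof.
elim: k c => [|k IH] c /=; first by move=> x _; exact: cst_continuous.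
by move=> a; rewrite partial_cst; split => // x _; exact: derivable_cst.
Qed.

Lemma partialD a f g x : derivable f x 'e_a -> derivable g x 'e_a ->
  partial a (fun y => f y + g y) x = partial a f x + partial a g x.
Proof. by move=> df dg; rewrite /partial -deriveD. Qed.

Lemma partialN a f x : derivable f x 'e_a ->
  partial a (fun y => - f y) x = - partial a f x.
Proof. by move=> df; rewrite /partial -deriveN. Qed.

Lemma partialB a f g x : derivable f x 'e_a -> derivable g x 'e_a ->
  partial a (fun y => f y - g y) x = partial a f x - partial a g x.
Proof. by move=> df dg; rewrite /partial -deriveB. Qed.

Lemma partialM a f g x : derivable f x 'e_a -> derivable g x 'e_a ->
  partial a (fun y => f y * g y) x = f x * partial a g x + g x * partial a f x.
Proof. by move=> df dg; rewrite /partial [LHS](deriveM df dg). Qed.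

Lemma partialV a f x : f x != 0 -> derivable f x 'e_a ->
  partial a (fun y => (f y)^-1) x = - ((f x)^-1 * (f x)^-1 * partial a f x).
Proof.
move=> f0 df; rewrite /partial [LHS](deriveV f0 df).
by rewrite expr2 invfM; exact: mulNr.
Qed.

Lemma Ck_onD k U f g : open U -> Ck_on k U f -> Ck_on k U g ->
  Ck_on k U (fun y => f y + g y).
Proof.
move=> oU; elim: k f g => [|k IH] f g Hf Hg.
  by move=> x Ux; apply: continuousD; [exact: Hf|exact: Hg].
move=> a; have [Hf1 Hf2] := Hf a; have [Hg1 Hg2] := Hg a; split.
  by move=> x Ux; apply: derivableD; auto.
apply: Ck_on_eq (IH _ _ Hf2 Hg2) => // y Uy.
by rewrite partialD //; auto.
Qed.

Lemma Ck_onN k U f : open U -> Ck_on k U f -> Ck_on k U (fun y => - f y).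
Proof.
move=> oU; elim: k f => [|k IH] f Hf.
  by move=> x Ux; apply: continuousN; exact: Hf.
move=> a; have [Hf1 Hf2] := Hf a; split.
  by move=> x Ux; apply: derivableN; auto.
apply: Ck_on_eq (IH _ Hf2) => // y Uy.
by rewrite partialN //; auto.
Qed.

Lemma Ck_onM k U f g : open U -> Ck_on k U f -> Ck_on k U g ->
  Ck_on k U (fun y => f y * g y).
Proof.
move=> oU; elim: k f g => [|k IH] f g Hf Hg.
  by move=> x Ux; apply: continuousM; [exact: Hf|exact: Hg].
move=> a; have [Hf1 Hf2] := Hf a; have [Hg1 Hg2] := Hg a; split.
  by move=> x Ux; apply: derivableM; auto.
have H : Ck_on k U (fun y => f y * partial a g y + g y * partial a f y).
  by apply: Ck_onD => //; apply: IH => //; exact: Ck_onW.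
apply: Ck_on_eq H => // y Uy.
by rewrite partialM //; auto.
Qed.

Lemma Ck_onV k U f : open U -> (forall x, U x -> f x != 0) -> Ck_on k U f ->
  Ck_on k U (fun y => (f y)^-1).
Proof.
move=> oU f0; elim: k => [|k IH] Hf.
  by move=> x Ux; apply: continuousV; [exact: f0|exact: Hf].
move=> a; have [Hf1 Hf2] := Hf a; split.
  by move=> x Ux; apply: derivableV; auto.
have Hi : Ck_on k U (fun y => (f y)^-1) by apply: IH; exact: Ck_onW.
have H : Ck_on k U (fun y => - ((f y)^-1 * (f y)^-1 * partial a f y)).
  by apply: Ck_onN => //; do ! apply: Ck_onM => //.
apply: Ck_on_eq H => // y Uy.
by rewrite partialV //; auto.
Qed.

Lemma Ck_on_sum k U (I : Type) (r : seq I) (P : pred I) (F : I -> 'rV[R]_n -> R) :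
  open U -> (forall i, P i -> Ck_on k U (F i)) ->
  Ck_on k U (fun y => \sum_(i <- r | P i) F i y).
Proof.
move=> oU HF; elim: r => [|i r IH].
  have -> : (fun y => \sum_(i <- [::] | P i) F i y) = (fun=> 0).
    by apply/funext => y; rewrite big_nil.
  exact: Ck_on_cst.
have -> : (fun y => \sum_(i <- i :: r | P i) F i y) =
    (fun y => (if P i then F i y else 0) + \sum_(i <- r | P i) F i y).
  by apply/funext => y; rewrite big_cons; case: ifP => //; rewrite add0r.
by apply: Ck_onD => //; case: (P i) (HF i) => [H|_]; [exact: H|exact: Ck_on_cst].
Qed.

Lemma Ck_on_prod k U (I : Type) (r : seq I) (P : pred I) (F : I -> 'rV[R]_n -> R) :
  open U -> (forall i, P i -> Ck_on k U (F i)) ->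
  Ck_on k U (fun y => \prod_(i <- r | P i) F i y).
Proof.
move=> oU HF; elim: r => [|i r IH].
  have -> : (fun y => \prod_(i <- [::] | P i) F i y) = (fun=> 1).
    by apply/funext => y; rewrite big_nil.
  exact: Ck_on_cst.
have -> : (fun y => \prod_(i <- i :: r | P i) F i y) =
    (fun y => (if P i then F i y else 1) * \prod_(i <- r | P i) F i y).
  by apply/funext => y; rewrite big_cons; case: ifP => //; rewrite mul1r.
by apply: Ck_onM => //; case: (P i) (HF i) => [H|_]; [exact: H|exact: Ck_on_cst].
Qed.

Lemma derivable_coord_fun a (c : 'I_n) x : derivable (fun y : 'rV[R]_n => y 0 c) x 'e_a.
Proof. by apply: diff_derivable; exact: differentiable_coord. Qed.

Lemma partial_coord a (c : 'I_n) : partial a (fun y : 'rV[R]_n => y 0 c) = (fun=> (c == a)%:R).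
Proof.
apply/funext => x; rewrite /partial /derive.
apply: cvg_lim => //; apply: (@cvg_trans _ (cst (c == a)%:R @ (0 : R)^')).
  apply: near_eq_cvg; near=> h.
  have h0 : h != 0 by near: h; exact: nbhs_dnbhs_neq.
  rewrite /= /shift /= !mxE eqxx /= addrK.
  by rewrite /GRing.scale /= mulrA mulVf // mul1r.
exact: cvg_cst.
Unshelve. all: by end_near. Qed.

Lemma Ck_on_coord k U (c : 'I_n) : Ck_on k U (fun y : 'rV[R]_n => y 0 c).
Proof.
case: k => [|k]; first by move=> x _; apply: differentiable_continuous;
  exact: differentiable_coord.
move=> a; rewrite partial_coord; split; last exact: Ck_on_cst.
by move=> x _; exact: derivable_coord_fun.
Qed.

(** The mean value theorem applied first along [a] and then along [b]. The second
    difference on the left is symmetric in [a] and [b], whence [partial_comm]. *)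
Lemma second_difference U f a b x (d h : R) :
  (forall a y, U y -> derivable f y 'e_a) ->
  (forall y, U y -> derivable (partial a f) y 'e_b) ->
  (forall y, `|y - x| < d -> U y) -> 0 < h -> h + h < d ->
  exists2 z, `|z - x| < d &
    f (x + h *: 'e_a + h *: 'e_b) - f (x + h *: 'e_a) - (f (x + h *: 'e_b) - f x)
    = h * h * partial b (partial a f) z.
Proof.
move=> df ddf ball_U h0 hd.
have normZe (t : R) c : `|t *: ('e_c : 'rV[R]_n)| <= `|t|.
  apply: norm_rV_le => // j; rewrite !mxE eqxx /=.
  by case: (j == c); rewrite ?mulr1 // mulr0 normr0.
have near_x t s : `|t| <= `|h| -> `|s| <= `|h| ->
    `|x + t *: 'e_a + s *: 'e_b - x| < d.
  move=> th sh; rewrite -[x + _ + _]addrA [x + _]addrC addrK.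
  rewrite (ger0_norm (ltW h0)) in th sh.
  apply: le_lt_trans (ler_normD _ _) _; apply: le_lt_trans hd.
  by apply: lerD; apply: le_trans (normZe _ _) _.
have near_x0 t : `|t| <= `|h| -> `|x + t *: 'e_a - x| < d.
  by move=> th; rewrite -[x + _]addr0 -(scale0r ('e_b)); apply: near_x; rewrite ?normr0.
pose g y := f (y + h *: 'e_b) - f y.
have dg t : `|t| <= `|h| -> is_derive (x + t *: 'e_a) 'e_a g
    (partial a f (x + t *: 'e_a + h *: 'e_b) - partial a f (x + t *: 'e_a)).
  move=> th; apply: is_deriveB.
    by apply: shift_is_derive; apply: df; apply: ball_U; exact: near_x.
  by apply: DeriveDef => //; apply: df; apply: ball_U; exact: near_x0.
have [t /dg [] // |t th E1] := @partial_MVT g a x h.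
have [s sh|s sh E2] := @partial_MVT (partial a f) b (x + t *: 'e_a) h.
  by apply: ddf; apply: ball_U; exact: near_x.
exists (x + t *: 'e_a + s *: 'e_b); first exact: near_x.
rewrite -mulrA -E2; have [_ <-] := dg _ th.
by rewrite -[RHS]E1 /g.
Qed.

Lemma eq_of_near_values (p q : 'rV[R]_n -> R) x :
  {for x, continuous p} -> {for x, continuous q} ->
  (\forall d \near 0^'+, exists z w, [/\ `|z - x| < d, `|w - x| < d & p z = q w]) ->
  p x = q x.
Proof.
move=> cp cq pq.
apply/eqP; rewrite -subr_eq0 -normr_le0; apply/ler_addgt0Pr => e e0; rewrite add0r.
have e20 : 0 < e / 2 by rewrite divr_gt0.
have ncf (g : 'rV[R]_n -> R) : {for x, continuous g} ->
    \forall d \near 0^'+, forall y, `|y - x| < d -> `|g x - g y| < e / 2.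
  move=> /cvgrPdist_lt /(_ _ e20) /nbhs_ballP [d /= d0 Bd].
  near=> r => y yr; apply: Bd; rewrite -ball_normE /= distrC.
  by apply: lt_trans yr _; near: r; exact: nbhs_right_lt.
near (0 : R)^'+ => d.
have [z [w [zd wd pzqw]]] : exists z w, [/\ `|z - x| < d, `|w - x| < d & p z = q w].
  by near: d.
have Hp : `|p x - p z| < e / 2 by move: z zd {pzqw}; near: d; exact: ncf.
have Hq : `|q x - q w| < e / 2 by move: w wd {pzqw}; near: d; exact: ncf.
rewrite -(subrKA (p z)) {2}pzqw.
apply: le_trans (ler_normD _ _) _.
by rewrite [leRHS]splitr (distrC (q w)); apply: lerD; exact: ltW.
Unshelve. all: by end_near. Qed.

Lemma partial_comm U f a b x : open U -> Ck_on 2 U f -> U x ->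
  partial a (partial b f) x = partial b (partial a f) x.
Proof.
move=> oU Hf Ux.
have df c y : U y -> derivable f y 'e_c by have [H _] := Hf c; exact: H.
have ddf c c' y : U y -> derivable (partial c f) y 'e_c'.
  by have [_ H] := Hf c; have [H' _] := H c'; exact: H'.
have cf c c' : {for x, continuous (partial c' (partial c f))}.
  by have [_ H] := Hf c; have [_ H'] := H c'; exact: H'.
have SD d h c c' := @second_difference U f c c' x d h df (ddf c c').
have [d0 /= d00 Bd] := (nbhs_ballP _ _).1 (open_nbhs_nbhs (conj oU Ux)).
apply: (eq_of_near_values (cf b a) (cf a b)); near=> d.
have d_gt0 : 0 < d by near: d; exact: nbhs_right_gt.
have BU y : `|y - x| < d -> U y.
  move=> yd; apply: Bd; rewrite -ball_normE /= distrC.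
  by apply: lt_trans yd _; near: d; exact: nbhs_right_lt.
pose h := d / 3.
have h0 : 0 < h by rewrite divr_gt0.
have hd : h + h < d by rewrite /h; lra.
have [z1 B1 E1] := SD d h b a BU h0 hd.
have [z2 B2 E2] := SD d h a b BU h0 hd.
exists z1, z2; split; [exact: B1|exact: B2|].
apply: (@mulfI _ (h * h)); first by rewrite mulf_neq0 // gt_eqF.
apply: etrans (etrans (esym E1) _) E2; rewrite [x + h *: 'e_b + _]addrAC.
have swap (p q r s : R) : p - q - (r - s) = p - r - (q - s) by ring.
exact: swap.
Unshelve. all: by end_near. Qed.

End PartialDerivatives.

Section ChainRule.
Context {R : realType} {m n : nat}.
Implicit Types (U : set 'rV[R]_m) (V : set 'rV[R]_n).
Implicit Types (f : 'rV[R]_n -> R) (phi : 'rV[R]_m -> 'rV[R]_n).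

Lemma differentiable_rV phi x :
  (forall c, differentiable (fun y => phi y 0 c : R) x) -> differentiable phi x.
Proof.
move=> dphi.
have -> : phi = \sum_(c < n) (fun y => phi y 0 c *: delta_mx 0 c : 'rV[R]_n).
  by apply/funext => y; rewrite {1}(row_sum_delta (phi y)) fct_sumE.
by apply: differentiable_sum => c; apply: differentiableZl.
Qed.

Lemma continuous_rV phi (x : 'rV[R]_m) :
  (forall c, {for x, continuous (fun y => phi y 0 c : R)}) -> {for x, continuous phi}.
Proof.
move=> cphi; suff : phi y @[y --> x] --> phi x by [].
apply/(@cvgrPdist_le R 'rV[R]_n _ (nbhs x)) => e e0.
have : \forall y \near x, forall c, `|phi x 0 c - phi y 0 c| <= e.
  apply: (@filter_forall _ _ (fun c y => `|phi x 0 c - phi y 0 c| <= e) (nbhs x)) => c.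
  by have /cvgrPdist_le := cphi c; apply.
apply: filterS => y Hy; apply: norm_rV_le => [|c]; first exact: ltW.
by rewrite !mxE.
Qed.

Lemma partial_comp f phi a x :
  (forall c, differentiable (fun y => phi y 0 c : R) x) ->
  differentiable f (phi x) ->
  partial a (f \o phi) x =
  \sum_c partial c f (phi x) * partial a (fun y => phi y 0 c) x.
Proof.
move=> dphi df; have dp := differentiable_rV dphi.
rewrite /partial deriveE; last exact: differentiable_comp.
rewrite diff_comp //= -(deriveE _ dp) derive_mx; last exact: diff_derivable.
rewrite [in LHS](row_sum_delta (\matrix_(i, j) _)) linear_sum /=.
by apply: eq_bigr => c _; rewrite linearZ /= !mxE -deriveE // mulrC.
Qed.

Lemma Ck_on_comp k U V f phi : open U -> open V ->
  (forall x, U x -> V (phi x)) ->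
  (forall c, Ck_on k U (fun y => phi y 0 c)) -> Ck_on k V f ->
  Ck_on k U (fun y => f (phi y)).
Proof.
move=> oU oV UV; elim: k f => [|k IH] f Hphi Hf.
  move=> x Ux; apply: continuous_comp; last exact: Hf (UV _ Ux).
  by apply: continuous_rV => c; exact: Hphi.
have dphi x c : U x -> differentiable (fun y => phi y 0 c : R) x.
  by move=> Ux; apply: Ck_on_differentiable Ux; [exact: oU|exact: Hphi].
have df x : U x -> differentiable f (phi x).
  by move=> Ux; apply: Ck_on_differentiable (UV _ Ux); [exact: oV|exact: Hf].
move=> a; split.
  move=> x Ux; apply: diff_derivable; apply: differentiable_comp; last exact: df.
  by apply: differentiable_rV => c; exact: dphi.
have H : Ck_on k U (fun y => \sum_c partial c f (phi y) * partial a (fun y => phi y 0 c) y).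
  apply: Ck_on_sum => // c _; apply: Ck_onM => //.
    apply: IH; last by have [] := Hf c.
    by move=> c'; exact: Ck_onW.
  by have [] := Hphi c a.
apply: Ck_on_eq H => // y Uy.
by rewrite (@partial_comp f phi) //; [move=> c; exact: dphi|exact: df].
Qed.

End ChainRule.

(** * Smooth matrix inverses and cutoff functions *)

Section SmoothMatrices.
Context {R : realType} {n : nat}.
Implicit Types (U : set 'rV[R]_n).

Lemma Ck_on_det k U m (A : 'rV[R]_n -> 'M[R]_m) : open U ->
  (forall i j, Ck_on k U (fun y => A y i j)) -> Ck_on k U (fun y => \det (A y)).
Proof.
move=> oU HA; apply: Ck_on_sum => // s _; apply: Ck_onM => //; first exact: Ck_on_cst.
by apply: Ck_on_prod.
Qed.

Lemma Ck_on_invmx k U m (A : 'rV[R]_n -> 'M[R]_m) i j : open U ->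
  (forall i j, Ck_on k U (fun y => A y i j)) ->
  (forall x, U x -> A x \in unitmx) -> Ck_on k U (fun y => invmx (A y) i j).
Proof.
move=> oU HA uA.
have H : Ck_on k U (fun y => (\det (A y))^-1 *
    ((-1) ^+ (j + i) * \det (row' j (col' i (A y))))).
  apply: Ck_onM => //.
    by apply: Ck_onV => // [x /uA|]; [rewrite unitmxE unitfE|exact: Ck_on_det].
  apply: Ck_onM => //; first exact: Ck_on_cst.
  apply: Ck_on_det => // i' j'.
  have -> : (fun y => row' j (col' i (A y)) i' j') = (fun y => A y (lift j i') (lift i j')).
    by apply/funext => y; rewrite !mxE.
  exact: HA.
apply: Ck_on_eq H => // y Uy.
by rewrite /invmx uA // !mxE.
Qed.

End SmoothMatrices.

Section FlatFunctions.
Context {R : realType}.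

(** The function t^{-m} exp (-1/t), extended by zero to t <= 0. The whole family
    in [m] is needed since it is closed under differentiation up to linear
    combinations ([is_derive_flat]), which makes all its members smooth. *)
Definition flat (m : nat) (t : R) : R :=
  if 0 < t then t^-1 ^+ m * expR (- t^-1) else 0.

Lemma flat_gt0 m t : 0 < t -> 0 < flat m t.
Proof. by move=> t0; rewrite /flat t0 mulr_gt0 ?expR_gt0 ?exprn_gt0 ?invr_gt0. Qed.

Lemma flat_ge0 m t : 0 <= flat m t.
Proof.
by have [/flat_gt0 /ltW //|t0] := ltP 0 t; rewrite /flat ltNge t0.
Qed.

Lemma flat_le0 m t : t <= 0 -> flat m t = 0.
Proof. by move=> t0; rewrite /flat ltNge t0. Qed.

(** From 1 + u <= exp u at u = s / k, raised to the power [k]. *)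
Lemma exprn_le_expR k (s : R) : 0 <= s -> s ^+ k <= k%:R ^+ k * expR s.
Proof.
move=> s0; case: k => [|k]; first by rewrite !expr0 mul1r;
  apply: le_trans (expR_ge1Dx s); rewrite lerDl.
have -> : expR s = expR (s / k.+1%:R) ^+ k.+1.
  by rewrite -expRM_natl mulrCA divff ?mulr1 ?pnatr_eq0.
rewrite -exprMn lerXn2r ?nnegrE ?mulr_ge0 ?expR_ge0 //.
rewrite -ler_pdivrMl // mulrC; apply: le_trans (expR_ge1Dx _); by rewrite lerDr.
Qed.

(** The quadratic bound gives derivative zero at the origin. *)
Lemma flat_bound m : exists C, forall t, `|flat m t| <= C * t ^+ 2.
Proof.
exists ((m + 2)%:R ^+ (m + 2)) => t; have [t0|t0] := ltP 0 t; last first.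
  by rewrite flat_le0 // normr0 mulr_ge0 ?sqr_ge0 // exprn_ge0.
rewrite ger0_norm ?flat_ge0 // /flat t0 expRN.
have ti : 0 <= t^-1 by rewrite invr_ge0 ltW.
have := exprn_le_expR (m + 2) ti.
rewrite exprD -ler_pdivrMr ?expR_gt0 // mulrAC [t^-1 ^+ 2]exprVn.
by rewrite ler_pdivrMr ?exprn_gt0.
Qed.

Lemma is_derive_flat m (t : R) :
  is_derive t 1 (flat m) (flat m.+2 t - m%:R * flat m.+1 t).
Proof.
have [t0|t0|<-] := ltgtP 0 t.
- have t0' : t != 0 by rewrite gt_eqF.
  apply: (@near_eq_is_derive R R R (fun t : R => t^-1 ^+ m * expR (- t^-1)) (flat m) t 1).
    near=> y; rewrite /flat ifT //; near: y.
    exact: lt_nbhsr t0.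
  rewrite /flat t0.
  have deq (f : R -> R) (d d' : R) : d = d' -> is_derive t 1 f d -> is_derive t 1 f d'.
    by move=> ->.
  have dinv : is_derive t 1 (fun y : R => y^-1) (- t^-1 ^+ 2).
    apply: deq (@is_deriveV R id t 1 1 t0' (is_derive_id _ _)).
    by rewrite -exprVn /GRing.scale /= mulr1.
  have dopp : is_derive t 1 (fun y : R => - y^-1) (t^-1 ^+ 2).
    by have := is_deriveN dinv; rewrite opprK.
  have dexp := @is_derive1_comp R expR (fun y => - y^-1) t _ _ (is_derive_expR (- t^-1)) dopp.
  have dpow := is_deriveX m dinv.
  have powE : (fun y : R => y^-1) ^+ m = (fun y : R => y^-1 ^+ m).
    by elim: m {dpow} => [//|m IH]; apply/funext => y; rewrite !exprS IH.
  rewrite powE in dpow; apply: deq (is_deriveM dpow dexp).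
  rewrite /= /GRing.scale /=; case: m {dpow powE} => [|m] /=; first by rewrite !mulr0n; ring.
  by rewrite !exprS; ring.
- rewrite !flat_le0 ?ltW // mulr0 subrr.
  apply: (@near_eq_is_derive R R R (cst 0) (flat m) t 1).
  near=> y; rewrite /= flat_le0 // ltW //; near: y.
  exact: lt_nbhsl t0.
rewrite !flat_le0 // mulr0 subrr.
have [C HC] := flat_bound m.
suff cv : h^-1 *: ((flat m \o shift (0 : R)) (h *: (1 : R)) - flat m 0)
    @[h --> (0 : R)^'] --> (0 : R).
  by apply: DeriveDef; [apply/cvg_ex; exists 0|exact: cvg_lim].
apply/cvgrPdist_le => e e0; near=> h.
have h0 : h != 0 by near: h; exact: nbhs_dnbhs_neq.
have he : `|h| <= e / (`|C| + 1).
  by near: h; apply: dnbhs0_le; rewrite divr_gt0.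
rewrite /= /shift /= addr0 (flat_le0 m (lexx 0)) subr0 sub0r normrN.
rewrite [h *: 1]mulr1 normrZ normfV ler_pdivrMl ?normr_gt0 //.
apply: le_trans (HC h) _.
have C1 : 0 < `|C| + 1 by rewrite ltr_wpDl.
rewrite -real_normK ?num_real // expr2 mulrA mulrC.
rewrite ler_wpM2l //.
apply: (@le_trans _ _ ((`|C| + 1) * `|h|)).
  by rewrite ler_wpM2r //; apply: le_trans (ler_norm _) _; rewrite lerDl.
by rewrite mulrC -ler_pdivlMr.
Unshelve. all: by end_near. Qed.

End FlatFunctions.

Section Cutoff.
Context {R : realType} {n : nat}.
Implicit Types (U : set 'rV[R]_n) (u : 'rV[R]_n -> R).

Lemma Ck_on_flat k m U u : open U -> Ck_on k U u -> Ck_on k U (fun y => flat m (u y)).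
Proof.
have dflat i (t : R) : derivable (flat i) t 1 by have [] := is_derive_flat i t.
move=> oU; elim: k m => [|k IH] m Hu.
  move=> x Ux; apply: continuous_comp; first exact: Hu.
  by apply: differentiable_continuous; apply/derivable1_diffP.
have df x : U x -> differentiable u x by move=> Ux; exact: Ck_on_differentiable Hu Ux.
have dg t : differentiable (@flat R m) t by apply/derivable1_diffP.
move=> a; split.
  move=> x Ux; apply: diff_derivable; apply: differentiable_comp; [exact: df|exact: dg].
have H : Ck_on k U (fun y => (flat m.+2 (u y) - m%:R * flat m.+1 (u y)) * partial a u y).
  apply: Ck_onM => //; last by have [] := Hu a.
  have Hu' := Ck_onW oU Hu.
  apply: Ck_onD => //; first exact: IH.
  by apply: Ck_onN => //; apply: Ck_onM => //; [exact: Ck_on_cst|exact: IH].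
apply: Ck_on_eq H => // y Uy.
rewrite /partial [RHS]deriveE; last by apply: differentiable_comp; [exact: df|exact: dg].
rewrite (diff_comp (df _ Uy) (dg _)) /= -(deriveE _ (df _ Uy)).
rewrite deriv1E //; have [_ <-] := is_derive_flat m (u y).
by rewrite derive1E /GRing.scale /= mulrC.
Qed.

(** A smooth function equal to 1 near [x0] and supported in a compact subset of
    a prescribed neighbourhood. *)
Lemma smooth_cutoff U (x0 : 'rV[R]_n) : open U -> U x0 ->
  exists (rho : 'rV[R]_n -> R) (V K : set 'rV[R]_n),
    [/\ smooth_on setT rho,
        open V /\ V x0,
        V `<=` K /\ K `<=` U,
        compact K &
        (forall y, V y -> rho y = 1) /\ (forall y, ~ K y -> rho y = 0)].
Proof.
move=> oU Ux0.
have [r /= r0 Br] := (nbhs_ballP _ _).1 (open_nbhs_nbhs (conj oU Ux0)).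
pose q := r / 2.
have q0 : 0 < q by rewrite divr_gt0.
pose N (y : 'rV[R]_n) : R := \sum_c (y 0 c - x0 0 c) ^+ 2.
have N_le (y : 'rV[R]_n) c : (y 0 c - x0 0 c) ^+ 2 <= N y.
  rewrite /N (bigD1 c) //= lerDl; apply: sumr_ge0 => ? _; exact: sqr_ge0.
have HN k : Ck_on k setT N.
  apply: Ck_on_sum => [|c _]; first exact: openT.
  by do !apply: Ck_onM => //; try exact: openT; apply: Ck_onD;
    (exact: openT || exact: Ck_on_coord || exact: Ck_on_cst).
(* The cutoff is A / (A + B): A vanishes for N >= q^2, B for N <= q^2 / 2, and
   these two regions do not meet, so that A + B is positive. *)
pose A y := flat 0 (q ^+ 2 - N y).
pose B y := flat 0 (N y - q ^+ 2 / 2).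
have AB y : 0 < A y + B y.
  have [H|H] := ltP (N y) (q ^+ 2).
    by apply: ltr_wpDr; [exact: flat_ge0|apply: flat_gt0; rewrite subr_gt0].
  apply: ltr_wpDl; [exact: flat_ge0|apply: flat_gt0].
  by rewrite subr_gt0; apply: lt_le_trans H; rewrite ltr_pdivrMr // ltr_pMr ?exprn_gt0 // ltr1n.
pose K := [set y : 'rV[R]_n | forall c, `[x0 0 c - q, x0 0 c + q]%classic (y ord0 c)].
exists (fun y => A y * (A y + B y)^-1), [set y | N y < q ^+ 2 / 2], K; split.
- move=> k; have HA : Ck_on k setT A.
    apply: Ck_on_flat; first exact: openT.
    apply: Ck_onD; [exact: openT|exact: Ck_on_cst|].
    by apply: Ck_onN; [exact: openT|exact: HN].
  have HB : Ck_on k setT B.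
    apply: Ck_on_flat; first exact: openT.
    by apply: Ck_onD; [exact: openT|exact: HN|exact: Ck_on_cst].
  apply: Ck_onM; [exact: openT|exact: HA|].
  apply: Ck_onV; [exact: openT| |].
    by move=> x _; rewrite gt_eqF.
  by apply: Ck_onD; [exact: openT|exact: HA|exact: HB].
- split.
    apply: (@open_comp _ _ N [set t | t < q ^+ 2 / 2]); last exact: open_lt.
    by move=> y _; exact: (HN 0%N y).
  rewrite /= /N big1 ?divr_gt0 ?exprn_gt0 // => c _.
  by rewrite subrr expr0n.
- split.
    move=> y /= Ny c; have H1 := le_lt_trans (N_le y c) Ny.
    have {}H1 : (y 0 c - x0 0 c) ^+ 2 < q ^+ 2.
      by apply: lt_trans H1 _; rewrite ltr_pdivrMr // ltr_pMr ?exprn_gt0 // ltr1n.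
    move: H1; rewrite -[X in X < _ -> _]real_normK ?num_real // ltr_pXn2r ?nnegrE ?(ltW q0) //.
    by rewrite ltr_norml /= in_itv /= => /andP[H1 H2]; apply/andP; split; lra.
  move=> y Ky; apply: Br; rewrite -ball_normE /=.
  apply: (@le_lt_trans _ _ q); last by rewrite /q; lra.
  apply: norm_rV_le => [|c]; first exact: ltW.
  have := Ky c; rewrite /= in_itv /= !mxE => /andP[H1 H2].
  by rewrite ler_norml; apply/andP; split; lra.
- apply: (@rV_compact _ _ (fun c => `[x0 0 c - q, x0 0 c + q]%classic)) => c.
  exact: segment_compact.
split=> [y /= Ny|y nK].
  rewrite {1}/B flat_le0 ?subr_le0 ?ltW // addr0 divff //.
  rewrite gt_eqF //; apply: flat_gt0; rewrite subr_gt0; apply: lt_trans Ny _.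
  by rewrite ltr_pdivrMr // ltr_pMr ?exprn_gt0 // ltr1n.
rewrite {1}/A flat_le0 ?mul0r // subr_le0.
have [c Hc] : exists c, ~ (`[x0 0 c - q, x0 0 c + q]%classic (y ord0 c)).
  by apply/existsNP.
apply: le_trans (N_le y c); rewrite -[leRHS]real_normK ?num_real //.
rewrite ler_pXn2r ?nnegrE ?(ltW q0) // leNgt; apply/negP => H; apply: Hc.
by move: H; rewrite ltr_norml /= in_itv /= => /andP[H1 H2]; apply/andP; split; lra.
Qed.

End Cutoff.

(** * Extension of chart functions to the manifold *)

Section TestFunctions.
Context (R : realType) (n : nat) (M : topologicalType) (X : smooth_manifold R n M).
Implicit Types i j : chart X.

Lemma open_img i : open (img i).
Proof. exact: img_open. Qed.

Lemma paramK i x : img i x -> coord i (param i x) = x.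
Proof. by move=> [p Dp <-]; rewrite coordK. Qed.

Lemma param_dom i x : img i x -> dom i (param i x).
Proof. by move=> [p Dp <-]; rewrite coordK. Qed.

Lemma open_preimage_param j (A : set M) : open A ->
  open [set x | img j x /\ A (param j x)].
Proof.
move=> oA; rewrite openE => x [Ix Ax]; rewrite /interior.
have nI : nbhs x (img j) by apply: open_nbhs_nbhs; split => //; exact: open_img.
have nA : nbhs x (param j @^-1` A).
  by apply: (param_continuous Ix); exact: open_nbhs_nbhs.
exact: filterI nI nA.
Qed.

Lemma overlapP i j x : overlap i j x <-> img i x /\ dom j (param i x).
Proof.
split=> [[p [Di Dj] <-]|[[p Dp <-]]]; first by rewrite coordK //; split => //; exists p.
by rewrite coordK // => Dj; exists p.
Qed.

Lemma overlap_open i j : open (overlap i j).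
Proof.
have -> : overlap i j = [set x | img i x /\ dom j (param i x)].
  by apply/seteqP; split => x /overlapP.
by apply: open_preimage_param; exact: dom_open.
Qed.

(** This is where the Hausdorff property of [M] is used. *)
Lemma compact_closed_param i (K : set 'rV[R]_n) : compact K -> K `<=` img i ->
  closed (param i @` K).
Proof.
move=> cK KI; apply: compact_closed (manifold_hausdorff X) _.
apply: continuous_compact => //; apply: continuous_in_subspaceT => x /set_mem /KI.
exact: param_continuous.
Qed.

(** Every smooth function of the coordinates agrees near a given point of the
    chart with a smooth function on [M]. *)
Lemma extend_by_zero i (F : 'rV[R]_n -> R) (x0 : 'rV[R]_n) :
  smooth_on setT F -> img i x0 ->
  exists (f : M -> R) (V : set 'rV[R]_n),
    [/\ smooth_function X f, open V, V x0, V `<=` img i &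
        forall y, V y -> local_rep i f y = F y].
Proof.
move=> sF Ix0.
have [rho [V [K [srho [oV Vx0] [VK KI] cK [rho1 rho0]]]]] := smooth_cutoff (@open_img i) Ix0.
pose G y := F y * rho y.
have sG k : Ck_on k setT G by apply: Ck_onM; [exact: openT|exact: sF|exact: srho].
pose f p := if `[< dom i p >] then G (coord i p) else 0.
exists f, V; split => //; last first.
- move=> y Vy; have Iy := KI _ (VK _ Vy).
  by rewrite /local_rep /f asboolT ?paramK //; [rewrite /G rho1 // mulr1|exact: param_dom].
- exact: subset_trans KI.
move=> j k.
(* The image of chart j is covered by two open sets: the overlap with chart i,
   and the set O of points outside the support, where f vanishes. *)
pose O := [set x | img j x /\ (~` (param i @` K)) (param j x)].
have oO : open O.
  by apply: open_preimage_param; apply: closed_openC; exact: compact_closed_param.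
apply: (@Ck_on_sub _ _ k (overlap j i `|` O)).
  move=> x Ix; have [D|nD] := pselect (dom i (param j x)).
    by left; apply/overlapP.
  right; split => // -[y Ky E]; apply: nD; rewrite -E; apply: param_dom; exact: KI.
apply: Ck_on_setU.
  have H : Ck_on k (overlap j i) (fun x => G (transition j i x)).
    apply: (@Ck_on_comp _ _ _ k _ setT) => //; [exact: overlap_open|exact: openT|].
    by move=> c; exact: transition_smooth.
  apply: Ck_on_eq H; first exact: overlap_open.
  by move=> x /overlapP [Ix Dx]; rewrite /local_rep /f asboolT.
apply: Ck_on_eq (Ck_on_cst k O 0) => // x [Ix nK].
rewrite /local_rep /f; case: asboolP => // D.
rewrite /G rho0 ?mulr0 // => Kx; apply: nK.
by exists (coord i (param j x)) => //; rewrite coordK.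
Qed.

End TestFunctions.

(** * Smooth functions on open sets *)

Section SmoothOn.
Context {R : realType} {n : nat}.
Implicit Types (U : set 'rV[R]_n) (f g : 'rV[R]_n -> R).
Local Notation "''e_' a" := (delta_mx 0 a : 'rV[R]_n) (at level 8, a at level 2).

Lemma smooth_on_derivable U f x a : smooth_on U f -> U x -> derivable f x 'e_a.
Proof. by move=> /(_ 1%N a) [H _]; exact: H. Qed.

Lemma smooth_on_partial U f a : smooth_on U f -> smooth_on U (partial a f).
Proof. by move=> H k; have [] := H k.+1 a. Qed.

Lemma smooth_on_eq U f g : open U -> (forall y, U y -> f y = g y) ->
  smooth_on U f -> smooth_on U g.
Proof. by move=> oU fg H k; exact: Ck_on_eq (H k). Qed.

Lemma smooth_on_cst U (c : R) : smooth_on U (fun=> c).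
Proof. by move=> k; exact: Ck_on_cst. Qed.

Lemma smooth_on_coord U (c : 'I_n) : smooth_on U (fun y : 'rV[R]_n => y 0 c).
Proof. by move=> k; exact: Ck_on_coord. Qed.

Lemma smooth_onD U f g : open U -> smooth_on U f -> smooth_on U g ->
  smooth_on U (fun y => f y + g y).
Proof. by move=> oU Hf Hg k; exact: Ck_onD. Qed.

Lemma smooth_onN U f : open U -> smooth_on U f -> smooth_on U (fun y => - f y).
Proof. by move=> oU Hf k; exact: Ck_onN. Qed.

Lemma smooth_onM U f g : open U -> smooth_on U f -> smooth_on U g ->
  smooth_on U (fun y => f y * g y).
Proof. by move=> oU Hf Hg k; exact: Ck_onM. Qed.

Lemma smooth_on_sum U (F : 'I_n -> 'rV[R]_n -> R) :
  open U -> (forall i, smooth_on U (F i)) -> smooth_on U (fun y => \sum_i F i y).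
Proof. by move=> oU HF k; apply: Ck_on_sum => // i _; exact: HF. Qed.

Lemma smooth_on_invmx U m (A : 'rV[R]_n -> 'M[R]_m) i j : open U ->
  (forall i j, smooth_on U (fun y => A y i j)) ->
  (forall x, U x -> A x \in unitmx) -> smooth_on U (fun y => invmx (A y) i j).
Proof. by move=> oU HA uA k; apply: Ck_on_invmx => // i' j'; exact: HA. Qed.

Lemma smooth_on_partial_comm U f a b x : open U -> smooth_on U f -> U x ->
  partial a (partial b f) x = partial b (partial a f) x.
Proof. by move=> oU Hf; apply: (partial_comm _ _ oU (Hf 2%N)). Qed.

Lemma partial_sum a (F : 'I_n -> 'rV[R]_n -> R) x :
  (forall i, derivable (F i) x 'e_a) ->
  partial a (fun y => \sum_i F i y) x = \sum_i partial a (F i) x.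
Proof.
move=> HF; have -> : (fun y => \sum_i F i y) = \sum_i F i.
  by apply/funext => y; rewrite fct_sumE.
exact: derive_sum.
Qed.

Lemma partial_cstM a (c : R) f x : derivable f x 'e_a ->
  partial a (fun y => c * f y) x = c * partial a f x.
Proof.
move=> df; rewrite (@partialM _ _ a (fun=> c) f x (derivable_cst _ _ _) df).
by rewrite partial_cst mulr0 addr0.
Qed.

End SmoothOn.

(** * Index sums *)

Section IndexSums.
Context {R : realType} {n : nat}.
Implicit Types (F : 'I_n -> 'I_n -> R) (T : 'I_n -> 'I_n -> 'I_n -> R).

(** Double and triple sums are named so that the linear algebra of index
    expressions can treat them as atoms. *)
Definition dsum F : R := \sum_a \sum_b F a b.

Definition tsum T : R := \sum_a \sum_b \sum_c T a b c.

Lemma dsumE F : \sum_a \sum_b F a b = dsum F.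
Proof. by []. Qed.

Lemma eq_dsum F F' : (forall a b, F a b = F' a b) -> dsum F = dsum F'.
Proof. by move=> FF'; apply: eq_bigr => a _; apply: eq_bigr => b _. Qed.

Lemma eq_tsum T T' : (forall a b c, T a b c = T' a b c) -> tsum T = tsum T'.
Proof. by move=> TT'; apply: eq_bigr => a _; exact: eq_dsum. Qed.

Lemma dsumD F F' : dsum (fun a b => F a b + F' a b) = dsum F + dsum F'.
Proof. by rewrite -big_split; apply: eq_bigr => a _; rewrite -big_split. Qed.

Lemma tsumD T T' : tsum (fun a b c => T a b c + T' a b c) = tsum T + tsum T'.
Proof. by rewrite -big_split; apply: eq_bigr => a _; exact: dsumD. Qed.

Lemma dsumN F : dsum (fun a b => - F a b) = - dsum F.
Proof. by rewrite -sumrN; apply: eq_bigr => a _; rewrite sumrN. Qed.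

Lemma tsumN T : tsum (fun a b c => - T a b c) = - tsum T.
Proof. by rewrite -sumrN; apply: eq_bigr => a _; exact: dsumN. Qed.

Lemma dsumZ k F : dsum (fun a b => k * F a b) = k * dsum F.
Proof. by rewrite /dsum mulr_sumr; apply: eq_bigr => a _; rewrite mulr_sumr. Qed.

Lemma tsumZ k T : tsum (fun a b c => k * T a b c) = k * tsum T.
Proof. by rewrite /tsum mulr_sumr; apply: eq_bigr => a _; exact: dsumZ. Qed.

Lemma dsumC F : dsum F = dsum (fun a b => F b a).
Proof. exact: exchange_big. Qed.

Lemma tsumC12 T : tsum T = tsum (fun a b c => T b a c).
Proof. exact: exchange_big. Qed.

Lemma tsumC23 T : tsum T = tsum (fun a b c => T a c b).
Proof. by apply: eq_bigr => a _; exact: exchange_big. Qed.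

Lemma sum_delta (F : 'I_n -> R) c : \sum_a F a * (c == a)%:R = F c.
Proof.
rewrite (bigD1 c) //= eqxx mulr1 big1 ?addr0 // => a ac.
by rewrite eq_sym (negPf ac) mulr0.
Qed.

(** The computation behind [laplace_commutator] at one point. [S] are the
    components of the field, [S1] and [S2] their first and second partial
    derivatives (derivative indices first); [H], [H1], [H2] and [L], [L1] are
    likewise the inverse metric and the 1-form lambda with their derivatives,
    and [psi1], [phi1] are the derivatives of psi and of the divergence. The last
    three hypotheses are the conformal Killing equation, its derivative along
    [f], and the derivative of the divergence. *)
Lemma commutator_index_identity
  (S L psi1 phi1 : 'I_n -> R) (psi : R) (S1 L1 H : 'I_n -> 'I_n -> R)
  (S2 H1 : 'I_n -> 'I_n -> 'I_n -> R) (H2 : 'I_n -> 'I_n -> 'I_n -> 'I_n -> R)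
  (c : 'I_n) :
  (forall a b, L1 a b = L1 b a) ->
  (forall a b e, S2 a b e = S2 b a e) ->
  (forall a b e f, H2 a b e f = H2 b a e f) ->
  (forall a b, \sum_d S d * H1 d a b =
     \sum_e (H e b * S1 e a + H a e * S1 e b) - psi * H a b) ->
  (forall f a b, \sum_d (S1 f d * H1 d a b + S d * H2 f d a b) =
     \sum_e ((H1 f e b * S1 e a + H e b * S2 f e a)
             + (H1 f a e * S1 e b + H a e * S2 f e b))
     - (psi1 f * H a b + psi * H1 f a b)) ->
  (forall a, phi1 a = \sum_b (S2 a b b + (L1 a b * S b + L b * S1 a b))) ->
  \sum_b S b * (\sum_a (H2 b a a c + (H1 b a c * L a + H a c * L1 b a)))
  - (\sum_a \sum_b H a b * S2 a b c
     + \sum_b (\sum_a (H1 a a b + H a b * L a)) * S1 b c)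
  = \sum_a H a c * (phi1 a - psi1 a) - psi * \sum_a (H1 a a c + H a c * L a).
Proof.
move=> L1C S2C H2C CK CK1 phi1E.
have A : dsum (fun f d => S1 f d * H1 d f c + S d * H2 f d f c) =
    dsum (fun f e => (H1 f e c * S1 e f + H e c * S2 f e f)
             + (H1 f f e * S1 e c + H f e * S2 f e c))
    - (\sum_f psi1 f * H f c + psi * \sum_f H1 f f c).
  rewrite mulr_sumr -big_split -sumrB; apply: eq_bigr => f _; exact: CK1.
have B : dsum (fun a d => L a * (S d * H1 d a c)) =
    dsum (fun a e => L a * (H e c * S1 e a) + L a * (H a e * S1 e c))
    - psi * \sum_a H a c * L a.
  rewrite mulr_sumr -sumrB; apply: eq_bigr => a _.
  rewrite -mulr_sumr CK mulrBr mulr_sumr; congr (_ - _); last by ring.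
  by apply: eq_bigr => e _; rewrite mulrDr.
have E1 : \sum_b S b * (\sum_a (H2 b a a c + (H1 b a c * L a + H a c * L1 b a))) =
   dsum (fun b a => S b * H2 a b a c) + (dsum (fun b a => L a * (S b * H1 b a c))
     + dsum (fun b a => S b * H a c * L1 b a)).
  rewrite -!dsumD; apply: eq_bigr => b _; rewrite mulr_sumr; apply: eq_bigr => a _.
  by rewrite (H2C b a); ring.
have E2 : \sum_b (\sum_a (H1 a a b + H a b * L a)) * S1 b c =
    dsum (fun b a => H1 a a b * S1 b c) + dsum (fun b a => L a * (H a b * S1 b c)).
  rewrite -!dsumD; apply: eq_bigr => b _; rewrite mulr_suml; apply: eq_bigr => a _; ring.
have E3 : \sum_a H a c * (phi1 a - psi1 a) = dsum (fun a b => H a c * S2 a b b)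
    + (dsum (fun a b => S b * H a c * L1 b a) + dsum (fun a b => L b * (H a c * S1 a b)))
    - \sum_f psi1 f * H f c.
  rewrite -!dsumD -sumrB; apply: eq_bigr => a _; rewrite phi1E mulrBr mulr_sumr.
  congr (_ - _); last by ring.
  by apply: eq_bigr => b _; rewrite (L1C b a); ring.
rewrite E1 E2 E3 dsumE big_split /=.
rewrite !dsumD in A B.
(* All terms are now double sums; they cancel up to exchanging the indices. *)
have X1 := dsumC (fun f d => S1 f d * H1 d f c).
have X2 := dsumC (fun f e => H e c * S2 f e f).
have X3 := dsumC (fun a e => L a * (H e c * S1 e a)).
have X4 := dsumC (fun b a => S b * H a c * L1 b a).
have X5 := dsumC (fun b a => S b * H2 a b a c).
have X6 := dsumC (fun b a => L a * (S b * H1 b a c)).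
have X7 := dsumC (fun b a => H1 a a b * S1 b c).
have X8 := dsumC (fun b a => L a * (H a b * S1 b c)).
have Y1 : dsum (fun a b => S1 b a * H1 a b c) = dsum (fun f e => H1 f e c * S1 e f).
  by apply: eq_dsum => a b; ring.
have Y2 : dsum (fun a b => H a c * S2 b a b) = dsum (fun a b => H a c * S2 a b b).
  by apply: eq_dsum => a b; rewrite (S2C b a).
have Y3 : dsum (fun a b => S a * H b c * L1 a b) = dsum (fun a b => S a * H b c * L1 b a).
  by apply: eq_dsum => a b; rewrite (L1C b a).
lra.
Qed.

(** The contraction of the Christoffel symbols with the inverse metric [H] at one
    point; [P a b e] and [H1 a b e] stand for the derivatives along [a] of the
    metric and of the inverse metric in the entry (b, e). *)
Lemma christoffel_index_identity (H : 'I_n -> 'I_n -> R) (P H1 : 'I_n -> 'I_n -> 'I_n -> R)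
  (c : 'I_n) :
  (forall a b, H a b = H b a) -> (forall a b e, P a b e = P a e b) ->
  (forall a b e, H1 a b e = - \sum_d \sum_f H b d * P a d f * H f e) ->
  \sum_a \sum_b H a b * (2^-1 * \sum_d H c d * (P a d b + P b d a - P d a b)) =
  - \sum_a (H1 a a c + H a c * (2^-1 * \sum_b \sum_d H b d * P a b d)).
Proof.
move=> HC PC H1E.
have E1 : \sum_a \sum_b H a b * (2^-1 * \sum_d H c d * (P a d b + P b d a - P d a b)) =
    2^-1 * (tsum (fun a b d => H a b * H c d * P a d b)
      + tsum (fun a b d => H a b * H c d * P b d a)
      - tsum (fun a b d => H a b * H c d * P d a b)).
  rewrite -tsumN -!tsumD -tsumZ; apply: eq_bigr => a _; apply: eq_bigr => b _.
  by rewrite !mulr_sumr; apply: eq_bigr => d _; ring.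
have E2 : \sum_a (H1 a a c + H a c * (2^-1 * \sum_b \sum_d H b d * P a b d)) =
    - tsum (fun a d f => H a d * P a d f * H f c)
    + 2^-1 * tsum (fun a b d => H a c * H b d * P a b d).
  rewrite big_split /= -sumrN; congr (_ + _); first by apply: eq_bigr => a _; exact: H1E.
  rewrite -tsumZ; apply: eq_bigr => a _; rewrite !mulr_sumr; apply: eq_bigr => b _.
  by rewrite !mulr_sumr; apply: eq_bigr => d _; ring.
have X1 : tsum (fun a d f => H a d * P a d f * H f c) =
    tsum (fun a b d => H a b * H c d * P a d b).
  by apply: eq_tsum => a b d; rewrite (PC a b d) (HC d c); ring.
have X2 : tsum (fun a b d => H a b * H c d * P b d a) =
    tsum (fun a b d => H a b * H c d * P a d b).
  by rewrite tsumC12; apply: eq_tsum => a b d; rewrite (HC b a).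
have X3 : tsum (fun a b d => H a b * H c d * P d a b) =
    tsum (fun a b d => H a c * H b d * P a b d).
  by rewrite tsumC23 tsumC12; apply: eq_tsum => a b d; rewrite (HC c a); ring.
rewrite E1 E2 X1 X2 X3; lra.
Qed.

End IndexSums.

(** * Metric, volume density and Laplacian in coordinates *)

Section ProductRule.
Context {R : realType} {n : nat} {U : set 'rV[R]_n}.
Implicit Types (f g : 'rV[R]_n -> R) (a : 'I_n).

Lemma smooth_partialD f g a x : smooth_on U f -> smooth_on U g -> U x ->
  partial a (fun y => f y + g y) x = partial a f x + partial a g x.
Proof. by move=> Hf Hg Ux; apply: partialD; exact: smooth_on_derivable Ux. Qed.

Lemma smooth_partialB f g a x : smooth_on U f -> smooth_on U g -> U x ->
  partial a (fun y => f y - g y) x = partial a f x - partial a g x.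
Proof. by move=> Hf Hg Ux; apply: partialB; exact: smooth_on_derivable Ux. Qed.

Lemma smooth_partialM f g a x : smooth_on U f -> smooth_on U g -> U x ->
  partial a (fun y => f y * g y) x = partial a f x * g x + f x * partial a g x.
Proof.
move=> Hf Hg Ux; rewrite addrC [partial a f x * _]mulrC.
by apply: partialM; exact: smooth_on_derivable Ux.
Qed.

Lemma smooth_partial_sum (F : 'I_n -> 'rV[R]_n -> R) a x :
  (forall i, smooth_on U (F i)) -> U x ->
  partial a (fun y => \sum_i F i y) x = \sum_i partial a (F i) x.
Proof. by move=> HF Ux; apply: partial_sum => i; exact: smooth_on_derivable Ux. Qed.

Lemma smooth_partial_sumM (f g : 'I_n -> 'rV[R]_n -> R) a x : open U ->
  (forall i, smooth_on U (f i)) -> (forall i, smooth_on U (g i)) -> U x ->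
  partial a (fun y => \sum_i f i y * g i y) x =
  \sum_i (partial a (f i) x * g i x + f i x * partial a (g i) x).
Proof.
move=> oU Hf Hg Ux; rewrite smooth_partial_sum //; last by move=> i; exact: smooth_onM.
by apply: eq_bigr => i _; rewrite smooth_partialM.
Qed.

End ProductRule.

Section LocalGeometry.
Context {R : realType} {n : nat}.
Implicit Types (G : 'rV[R]_n -> 'M[R]_n) (f : 'rV[R]_n -> R) (x : 'rV[R]_n).

(** The derivative along [a] of log sqrt (det G), by Jacobi's formula half the trace
    of G^{-1} d_a G. *)
Definition log_density_partial G (a : 'I_n) x : R :=
  2^-1 * \sum_b \sum_c ginv G x b c * partial a (fun y => G y b c) x.

(** The first order coefficients of the Laplace-Beltrami operator. *)
Definition laplace_drift G (c : 'I_n) x : R :=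
  \sum_a (partial a (fun y => ginv G y a c) x + ginv G x a c * log_density_partial G a x).

(** The Laplace-Beltrami operator nabla^a nabla_a in coordinates, without
    Christoffel symbols ([bochner_laplacianE]). *)
Definition laplace G f x : R :=
  \sum_a \sum_b ginv G x a b * partial a (partial b f) x
  + \sum_c laplace_drift G c x * partial c f x.

(** The entrywise derivative of the metric along [a]. *)
Definition metric_partial G (a : 'I_n) x : 'M[R]_n :=
  \matrix_(b, c) partial a (fun y => G y b c) x.

End LocalGeometry.

Section MetricIdentities.
Context {R : realType} {n : nat} {U : set 'rV[R]_n} {G : 'rV[R]_n -> 'M[R]_n}.
Hypotheses (oU : open U) (sG : forall a b, smooth_on U (fun x => G x a b)).
Hypotheses (symG : forall x, U x -> (G x)^T = G x).
Hypotheses (uG : forall x, U x -> G x \in unitmx).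
Local Notation H := (ginv G).

Lemma smooth_ginv a b : smooth_on U (fun x => H x a b).
Proof. exact: smooth_on_invmx. Qed.

Lemma ginv_sym x a b : U x -> H x a b = H x b a.
Proof. by move=> Ux; rewrite /ginv -{2}(symG Ux) -trmx_inv mxE. Qed.

Lemma metric_sym_entry x a b : U x -> G x a b = G x b a.
Proof. by move=> Ux; rewrite -{1}(symG Ux) mxE. Qed.

Lemma metric_partial_sym x a b c : U x ->
  partial a (fun y => G y b c) x = partial a (fun y => G y c b) x.
Proof. by apply: partial_eq_on => // y Uy; exact: metric_sym_entry. Qed.

Lemma ginv_partial_mx x a : U x ->
  \matrix_(b, c) partial a (fun y => H y b c) x
  = - (H x *m metric_partial G a x *m H x).
Proof.
move=> Ux.
have E : (\matrix_(b, c) partial a (fun y => H y b c) x) *m G x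
    + H x *m metric_partial G a x = 0.
  apply/matrixP => i j.
  have : partial a (fun y => \sum_k H y i k * G y k j) x = 0.
    rewrite (@partial_eq_on _ _ U _ (fun=> (i == j)%:R)) ?partial_cst // => y Uy.
    have := mulVmx (uG Uy) => /matrixP /(_ i j); by rewrite !mxE.
  rewrite (smooth_partial_sumM _ oU) //; last by move=> k; exact: smooth_ginv.
  move=> S; rewrite [RHS]mxE -S big_split [LHS]mxE.
  by congr (_ + _); rewrite mxE; apply: eq_bigr => k _; rewrite !mxE.
move/eqP: E; rewrite addr_eq0 => /eqP E.
by rewrite -[LHS]mulmx1 -(mulmxV (uG Ux)) mulmxA E mulNmx.
Qed.

Lemma ginv_partial x a b c : U x ->
  partial a (fun y => H y b c) x =
  - \sum_d \sum_e H x b d * partial a (fun y => G y d e) x * H x e c.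
Proof.
move=> /(ginv_partial_mx a) /matrixP /(_ b c); rewrite !mxE => ->; congr (- _).
rewrite exchange_big; apply: eq_bigr => e _; rewrite !mxE mulr_suml.
by apply: eq_bigr => d _; rewrite !mxE.
Qed.

Lemma smooth_log_density_partial a : smooth_on U (log_density_partial G a).
Proof.
apply: smooth_onM => //; first exact: smooth_on_cst.
apply: smooth_on_sum => // b; apply: smooth_on_sum => // c.
by apply: smooth_onM => //; [exact: smooth_ginv|exact: smooth_on_partial].
Qed.

Lemma smooth_laplace_drift c : smooth_on U (laplace_drift G c).
Proof.
apply: smooth_on_sum => // a; apply: smooth_onD => //.
  by apply: smooth_on_partial; exact: smooth_ginv.
by apply: smooth_onM => //; [exact: smooth_ginv|exact: smooth_log_density_partial].
Qed.

(** The second derivatives of the metric contribute symmetrically, and so does the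
    derivative of its inverse, as tr (H (d_a G) H (d_b G)) is symmetric in [a], [b]. *)
Lemma log_density_partial_closed x a b : U x ->
  partial a (log_density_partial G b) x = partial b (log_density_partial G a) x.
Proof.
move=> Ux.
have E a' b' : partial a' (log_density_partial G b') x =
   2^-1 * (- \tr (H x *m metric_partial G a' x *m (H x *m metric_partial G b' x))
     + \sum_c \sum_d H x c d * partial a' (partial b' (fun y => G y c d)) x).
  have sHG c d : smooth_on U (fun y => H y c d * partial b' (fun y => G y c d) y).
    by apply: smooth_onM => //; [exact: smooth_ginv|exact: smooth_on_partial].
  rewrite /log_density_partial (@partial_cstM _ _ a' 2^-1); last first.
    apply: (smooth_on_derivable (U := U)) => //.
    by apply: smooth_on_sum => // c; exact: smooth_on_sum.
  congr (_ * _); rewrite (smooth_partial_sum (U := U)) //; last by move=> c; exact: smooth_on_sum.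
  rewrite mulmxA /mxtrace -sumrN -big_split; apply: eq_bigr => c _ /=.
  rewrite (smooth_partial_sumM _ oU) //; last 2 first.
  - by move=> d; exact: smooth_ginv.
  - by move=> d; exact: smooth_on_partial.
  rewrite big_split /=; congr (_ + _).
  have -> : H x *m metric_partial G a' x *m H x *m metric_partial G b' x
     = - ((\matrix_(b, c) partial a' (fun y => H y b c) x) *m metric_partial G b' x).
    by rewrite ginv_partial_mx // mulNmx opprK.
  rewrite !mxE opprK; apply: eq_bigr => d _; rewrite !mxE; congr (_ * _).
  exact: metric_partial_sym.
have S : \sum_c \sum_d H x c d * partial a (partial b (fun y => G y c d)) x =
    \sum_c \sum_d H x c d * partial b (partial a (fun y => G y c d)) x.
  apply: eq_bigr => c _; apply: eq_bigr => d _.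
  by rewrite (smooth_on_partial_comm a b oU (sG c d) Ux).
have T := mxtrace_mulC (H x *m metric_partial G a x) (H x *m metric_partial G b x).
apply: etrans (E a b) (etrans _ (esym (E b a))).
exact: congr1 _ (congr2 _ (congr1 _ T) S).
Qed.

Lemma christoffel_trace x c : U x ->
  \sum_a \sum_b H x a b * christoffel G c a b x = - laplace_drift G c x.
Proof.
move=> Ux; apply: (@christoffel_index_identity R n (H x)
  (fun a b c => partial a (fun y => G y b c) x)
  (fun a b c => partial a (fun y => H y b c) x)).
- by move=> a b; exact: ginv_sym.
- by move=> a b e; exact: metric_partial_sym.
- by move=> a b e; exact: ginv_partial.
Qed.

Lemma divergenceE s x : U x ->
  divergence G s x = \sum_a \sum_b H x a b * partial a (fun y => s y 0 b) x
    + \sum_c laplace_drift G c x * s x 0 c.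
Proof.
move=> Ux; rewrite /divergence /nabla.
have -> : \sum_c laplace_drift G c x * s x 0 c =
    - \sum_a \sum_b \sum_c H x a b * (christoffel G c a b x * s x 0 c).
  have -> : \sum_a \sum_b \sum_c H x a b * (christoffel G c a b x * s x 0 c) =
      \sum_a \sum_c \sum_b H x a b * (christoffel G c a b x * s x 0 c).
    by apply: eq_bigr => a _; exact: exchange_big.
  rewrite exchange_big -sumrN; apply: eq_bigr => c _ /=.
  rewrite -[laplace_drift G c x]opprK -christoffel_trace // mulNr mulr_suml; congr (- _).
  by apply: eq_bigr => a _; rewrite mulr_suml; apply: eq_bigr => b _; rewrite mulrA.
rewrite -sumrB; apply: eq_bigr => a _; rewrite -sumrB; apply: eq_bigr => b _.
by rewrite mulrBr mulr_sumr.
Qed.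

Lemma bochner_laplacianE f x : U x -> bochner_laplacian G f x = - laplace G f x.
Proof.
move=> Ux; rewrite /bochner_laplacian divergenceE //; congr (- (_ + _)).
  apply: eq_bigr => a _; apply: eq_bigr => b _; congr (_ * partial a _ x).
  by apply/funext => y; rewrite mxE.
by apply: eq_bigr => c _; rewrite mxE.
Qed.

End MetricIdentities.

(** * Conformal Killing fields and their commutator with the Laplacian *)

Section ConformalField.
Context {R : realType} {n : nat} {U : set 'rV[R]_n} {G : 'rV[R]_n -> 'M[R]_n}.
Hypotheses (oU : open U) (sG : forall a b, smooth_on U (fun x => G x a b)).
Hypotheses (symG : forall x, U x -> (G x)^T = G x).
Hypotheses (uG : forall x, U x -> G x \in unitmx).
Context {s : 'rV[R]_n -> 'rV[R]_n}.
Hypothesis (ss : forall a, smooth_on U (fun x => s x 0 a)).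
Local Notation H := (ginv G).
Local Notation S := (raise G s).
Local Notation phi := (divergence G s).
Let sH := smooth_ginv oU sG uG.

Lemma smooth_raise a : smooth_on U (fun x => S x a).
Proof. by apply: smooth_on_sum => // b; exact: smooth_onM. Qed.

Lemma partial_raise a c x : U x -> partial a (fun y => S y c) x =
  \sum_b (partial a (fun y => H y c b) x * s x 0 b + H x c b * partial a (fun y => s y 0 b) x).
Proof. by move=> Ux; exact: (smooth_partial_sumM _ oU). Qed.

(** The usual formula for the divergence in terms of the volume density. *)
Lemma divergence_raise x : U x ->
  phi x = \sum_a (partial a (fun y => S y a) x + log_density_partial G a x * S x a).
Proof.
move=> Ux; rewrite (divergenceE oU sG symG uG) //.
have E1 : \sum_a (partial a (fun y => S y a) x + log_density_partial G a x * S x a) =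
    dsum (fun a b => partial a (fun y => H y a b) x * s x 0 b)
    + dsum (fun a b => H x a b * partial a (fun y => s y 0 b) x)
    + dsum (fun a b => log_density_partial G a x * (H x a b * s x 0 b)).
  rewrite -!dsumD; apply: eq_bigr => a _.
  by rewrite partial_raise // /raise mulr_sumr -big_split.
have E2 : \sum_c laplace_drift G c x * s x 0 c =
    dsum (fun c a => partial a (fun y => H y a c) x * s x 0 c)
    + dsum (fun c a => log_density_partial G a x * (H x a c * s x 0 c)).
  rewrite -!dsumD; apply: eq_bigr => c _; rewrite mulr_suml.
  by apply: eq_bigr => a _; ring.
rewrite E1 E2 dsumE.
rewrite (dsumC (fun c a => partial a (fun y => H y a c) x * s x 0 c)).
rewrite (dsumC (fun c a => log_density_partial G a x * (H x a c * s x 0 c))).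
by rewrite addrA [X in X + _ = _]addrC.
Qed.

Lemma smooth_divergence : smooth_on U phi.
Proof.
have sL := smooth_log_density_partial oU sG uG.
apply: (@smooth_on_eq _ _ U
  (fun x => \sum_a (partial a (fun y => S y a) x + log_density_partial G a x * S x a))).
- exact: oU.
- by move=> y /divergence_raise.
- apply: smooth_on_sum => // a; apply: smooth_onD => //.
    by apply: smooth_on_partial; exact: smooth_raise.
  by apply: smooth_onM => //; exact: smooth_raise.
Qed.

Lemma lower_raise x b : U x -> s x 0 b = \sum_d S x d * G x d b.
Proof.
move=> Ux.
have E : \row_d S x d = s x *m H x.
  apply/rowP => d; rewrite !mxE; apply: eq_bigr => c _.
  by rewrite mulrC (ginv_sym symG).
have := mulmxK (uG Ux) (s x *m H x); have := mulmxKV (uG Ux) (s x).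
rewrite -/(ginv G x) -E => <- _; rewrite mxE; apply: eq_bigr => d _.
by rewrite mxE.
Qed.

Lemma partial_lower a b x : U x -> partial a (fun y => s y 0 b) x =
  \sum_d (partial a (fun y => S y d) x * G x d b
          + S x d * partial a (fun y => G y d b) x).
Proof.
move=> Ux; rewrite -(smooth_partial_sumM _ oU) //; last by move=> d; exact: smooth_raise.
by apply: (partial_eq_on _ oU) => // y Uy; exact: lower_raise.
Qed.

Lemma christoffel_form a b x : U x ->
  \sum_c christoffel G c a b x * s x 0 c =
  2^-1 * \sum_d S x d * (partial a (fun y => G y d b) x + partial b (fun y => G y d a) x
     - partial d (fun y => G y a b) x).
Proof.
move=> Ux.
have -> : \sum_c christoffel G c a b x * s x 0 c =
   2^-1 * dsum (fun c d => H x c d * s x 0 c * (partial a (fun y => G y d b) x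
     + partial b (fun y => G y d a) x - partial d (fun y => G y a b) x)).
  rewrite -dsumZ; apply: eq_bigr => c _; rewrite /christoffel mulr_sumr mulr_suml.
  by apply: eq_bigr => d _; ring.
rewrite dsumC; congr (_ * _); apply: eq_bigr => d _; rewrite /raise mulr_suml.
by apply: eq_bigr => c _; rewrite (ginv_sym symG d c Ux).
Qed.

(** The symmetrized covariant derivative is the Lie derivative of the metric. *)
Lemma nabla_sym a b x : U x ->
  nabla G s a b x + nabla G s b a x =
  \sum_d (partial a (fun y => S y d) x * G x d b + partial b (fun y => S y d) x * G x d a
    + S x d * partial d (fun y => G y a b) x).
Proof.
move=> Ux; have half_sum (p q u v w z : R) :
    p + z * u - 2^-1 * (z * (u + v - w)) + (q + z * v - 2^-1 * (z * (v + u - w)))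
    = p + q + z * w.
  by field.
rewrite /nabla !partial_lower // !christoffel_form // !mulr_sumr -!sumrB -big_split.
apply: eq_bigr => d _ /=.
by rewrite (metric_partial_sym oU symG d b a Ux); exact: half_sum.
Qed.

Hypothesis ck : forall x, U x -> forall a b,
  2^-1 * (nabla G s a b x + nabla G s b a x) - n%:R^-1 * phi x * G x a b = 0.
Local Notation psi := (fun x => 2 / n%:R * phi x).

(** The conformal Killing equation in terms of the inverse metric: its Lie
    derivative along the field is [- psi] times itself. *)
Lemma conformal_killing_inverse a b x : U x ->
  \sum_d S x d * partial d (fun y => H y a b) x =
  \sum_e (H x e b * partial e (fun y => S y a) x + H x a e * partial e (fun y => S y b) x)
  - 2 / n%:R * phi x * H x a b.
Proof.
move=> Ux.
pose S1 : 'M[R]_n := \matrix_(a, d) partial a (fun y => S y d) x.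
have E : S1 *m G x + (S1 *m G x)^T + \sum_d S x d *: metric_partial G d x
    = (2 / n%:R * phi x) *: G x.
  apply/matrixP => i j; have := ck Ux i j; rewrite nabla_sym // => /eqP.
  rewrite subr_eq0 => /eqP E; rewrite [RHS]mxE -mulrA -[2 * _ * _]mulrA [n%:R^-1 * _]mulrA -E.
  rewrite mulVKf ?pnatr_eq0 // !big_split /= !mxE summxE.
  congr (_ + _ + _); apply: eq_bigr => d _; by rewrite !mxE.
have HS : H x *m G x = 1%:M by exact: mulVmx (uG Ux).
have GH : G x *m H x = 1%:M by exact: mulmxV (uG Ux).
have HT : (H x)^T = H x by rewrite /ginv trmx_inv symG.
(* Multiply by the inverse metric on both sides. *)
have {}E : H x *m S1 + (H x *m S1)^T + \sum_d S x d *: (H x *m metric_partial G d x *m H x)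
   = (2 / n%:R * phi x) *: H x.
  have := congr1 (fun A => H x *m A *m H x) E.
  rewrite -scalemxAr -scalemxAl HS mul1mx !mulmxDr !mulmxDl => <-.
  have -> : H x *m (S1 *m G x) *m H x = H x *m S1 by rewrite mulmxA -mulmxA GH mulmx1.
  have -> : H x *m (S1 *m G x)^T *m H x = (H x *m S1)^T.
    by rewrite !trmx_mul symG // HT mulmxA HS mul1mx.
  congr (_ + _); rewrite mulmx_sumr mulmx_suml; apply: eq_bigr => d _.
  by rewrite scalemxAl scalemxAr.
have -> : \sum_d S x d * partial d (fun y => H y a b) x =
   - (\sum_d S x d *: (H x *m metric_partial G d x *m H x)) a b.
  rewrite summxE -sumrN; apply: eq_bigr => d _.
  have /matrixP /(_ a b) := ginv_partial_mx oU sG uG d Ux.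
  by rewrite mxE => ->; rewrite !mxE mulrN.
have /matrixP /(_ a b) := E; rewrite mxE [RHS]mxE => <-.
rewrite mxE big_split /= !mxE.
have -> : \sum_e H x e b * partial e (fun y => S y a) x = \sum_j H x b j * S1 j a.
  by apply: eq_bigr => e _; rewrite mxE (ginv_sym symG e b Ux).
have -> : \sum_e H x a e * partial e (fun y => S y b) x = \sum_j H x a j * S1 j b.
  by apply: eq_bigr => e _; rewrite mxE.
ring.
Qed.

(** The first order part of the commutator of the field with the Laplacian. *)
Lemma laplace_commutator c x : U x ->
  \sum_b S x b * partial b (laplace_drift G c) x - laplace G (fun y => S y c) x =
  \sum_a H x a c * (partial a phi x - partial a psi x)
  - 2 / n%:R * phi x * laplace_drift G c x.
Proof.
move=> Ux.
have sL := smooth_log_density_partial oU sG uG.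
have sS := smooth_raise.
have sdH a b e : smooth_on U (partial a (fun y => H y b e)) by exact: smooth_on_partial.
have spsi : smooth_on U psi.
  by apply: smooth_onM => //; [exact: smooth_on_cst|exact: smooth_divergence].
have -> : \sum_b S x b * partial b (laplace_drift G c) x =
  \sum_b S x b * (\sum_a (partial b (partial a (fun y => H y a c)) x
    + (partial b (fun y => H y a c) x * log_density_partial G a x
       + H x a c * partial b (log_density_partial G a) x))).
  apply: eq_bigr => b _; congr (_ * _).
  rewrite (smooth_partial_sum (U := U)) //; last first.
    by move=> a; apply: smooth_onD => //; exact: smooth_onM.
  apply: eq_bigr => a _; rewrite (smooth_partialD (U := U)) //; last exact: smooth_onM.
  by rewrite (smooth_partialM (U := U)).
apply: (@commutator_index_identity R n (S x) (fun a => log_density_partial G a x)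
  (fun a => partial a psi x) (fun a => partial a phi x) (psi x)
  (fun a b => partial a (fun y => S y b) x) (fun a b => partial a (log_density_partial G b) x)
  (H x) (fun a b e => partial a (partial b (fun y => S y e)) x)
  (fun a b e => partial a (fun y => H y b e) x)
  (fun a b e f => partial a (partial b (fun y => H y e f)) x) c).
- by move=> a b; exact: (log_density_partial_closed oU sG symG uG).
- by move=> a b e; exact: (smooth_on_partial_comm _ _ oU).
- by move=> a b e f; exact: (smooth_on_partial_comm _ _ oU).
- by move=> a b; exact: conformal_killing_inverse.
- move=> f a b.
  have := partial_eq_on f oU (fun y => @conformal_killing_inverse a b y) Ux.
  rewrite (smooth_partial_sumM _ oU) //.
  move=> ->; rewrite (smooth_partialB (U := U)) //; last 2 first.
  - apply: smooth_on_sum => // e; apply: smooth_onD => //.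
      by apply: smooth_onM => //; exact: smooth_on_partial.
    by apply: smooth_onM => //; exact: smooth_on_partial.
  - exact: (@smooth_onM _ _ U psi).
  congr (_ - _); last exact: (@smooth_partialM _ _ U psi).
  rewrite (smooth_partial_sum (U := U)) //; last first.
    by move=> e; apply: smooth_onD => //; apply: smooth_onM => //; exact: smooth_on_partial.
  apply: eq_bigr => e _; rewrite (smooth_partialD (U := U)) //; last 2 first.
  - by apply: smooth_onM => //; exact: smooth_on_partial.
  - by apply: smooth_onM => //; exact: smooth_on_partial.
  by congr (_ + _); apply: (smooth_partialM (U := U)) => //; exact: smooth_on_partial.
- move=> a; rewrite (partial_eq_on a oU divergence_raise Ux).
  rewrite (smooth_partial_sum (U := U)) //; last first.
    by move=> b; apply: smooth_onD => //; [exact: smooth_on_partial|exact: smooth_onM].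
  apply: eq_bigr => b _; rewrite (smooth_partialD (U := U)) //; last 2 first.
  - exact: smooth_on_partial.
  - exact: smooth_onM.
  by congr (_ + _); apply: (smooth_partialM (U := U)).
Qed.

End ConformalField.

(** * The operators in coordinates *)

(** The zeroth order coefficient of the Yamabe operator. *)
Definition yamabe_potential {R : realType} {n : nat} (G : 'rV[R]_n -> 'M[R]_n)
    (x : 'rV[R]_n) : R :=
  (n%:R - 2) / (4 * (n%:R - 1)) * scalar_curvature G x.

Section Operators.
Context {R : realType} {n : nat} {U : set 'rV[R]_n} {G : 'rV[R]_n -> 'M[R]_n}.
Hypotheses (oU : open U) (sG : forall a b, smooth_on U (fun x => G x a b)).
Hypotheses (symG : forall x, U x -> (G x)^T = G x).
Hypotheses (uG : forall x, U x -> G x \in unitmx).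
Local Notation H := (ginv G).
Let sH := smooth_ginv oU sG uG.

Local Notation W := (yamabe_potential G).

Lemma smooth_yamabe_potential : smooth_on U W.
Proof.
have sC c a b : smooth_on U (christoffel G c a b).
  apply: smooth_onM; [exact: oU|exact: smooth_on_cst|].
  apply: smooth_on_sum => // d; apply: smooth_onM => //.
  apply: smooth_onD => //; last by apply: smooth_onN => //; exact: smooth_on_partial.
  by apply: smooth_onD => //; exact: smooth_on_partial.
apply: smooth_onM; [exact: oU|exact: smooth_on_cst|].
apply: smooth_on_sum => // a; apply: smooth_on_sum => // b; apply: smooth_onM => //.
apply: smooth_on_sum => // c; apply: smooth_onD => //.
  apply: smooth_onD => //; first exact: smooth_on_partial.
  by apply: smooth_onN => //; exact: smooth_on_partial.
apply: smooth_on_sum => // d; apply: smooth_onD => //; first exact: smooth_onM.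
by apply: smooth_onN => //; exact: smooth_onM.
Qed.

Lemma yamabeE f x : U x -> yamabe G f x = - laplace G f x + W x * f x.
Proof. by move=> Ux; rewrite /yamabe (bochner_laplacianE oU sG symG uG). Qed.

Lemma laplace_eq_on (V : set 'rV[R]_n) f g x : open V -> (forall y, V y -> f y = g y) ->
  V x -> laplace G f x = laplace G g x.
Proof.
move=> oV fg Vx; have E c y : V y -> partial c f y = partial c g y.
  by move=> Vy; exact: (partial_eq_on _ oV).
have E1 : \sum_c laplace_drift G c x * partial c f x = \sum_c laplace_drift G c x * partial c g x.
  by apply: eq_bigr => c _; rewrite (E c x Vx).
have E2 : \sum_a \sum_b H x a b * partial a (partial b f) x =
    \sum_a \sum_b H x a b * partial a (partial b g) x.
  apply: eq_bigr => a _; apply: eq_bigr => b _.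
  by rewrite (partial_eq_on a oV (E b) Vx).
exact: congr2 E2 E1.
Qed.

Lemma yamabe_eq_on (V : set 'rV[R]_n) f g x : open V -> V `<=` U ->
  (forall y, V y -> f y = g y) -> V x -> yamabe G f x = yamabe G g x.
Proof.
move=> oV VU fg Vx; rewrite !yamabeE; [|exact: VU|exact: VU].
by rewrite (laplace_eq_on oV fg Vx) (fg _ Vx).
Qed.

Lemma first_order_op_eq_on s A (V : set 'rV[R]_n) f g x : open V ->
  (forall y, V y -> f y = g y) -> V x -> first_order_op G s A f x = first_order_op G s A g x.
Proof.
move=> oV fg Vx; rewrite /first_order_op (fg _ Vx).
suff -> : \sum_a raise G s x a * partial a f x = \sum_a raise G s x a * partial a g x by [].
by apply: eq_bigr => c _; rewrite (partial_eq_on c oV fg Vx).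
Qed.

Lemma laplaceD f g x : smooth_on U f -> smooth_on U g -> U x ->
  laplace G (fun y => f y + g y) x = laplace G f x + laplace G g x.
Proof.
move=> sf sg Ux.
have E1 : \sum_c laplace_drift G c x * partial c (fun y => f y + g y) x =
    \sum_c laplace_drift G c x * partial c f x + \sum_c laplace_drift G c x * partial c g x.
  rewrite -big_split; apply: eq_bigr => c _ /=.
  by rewrite (smooth_partialD (U := U)) // mulrDr.
have E2 : \sum_a \sum_b H x a b * partial a (partial b (fun y => f y + g y)) x =
    dsum (fun a b => H x a b * partial a (partial b f) x)
    + dsum (fun a b => H x a b * partial a (partial b g) x).
  rewrite -dsumD; apply: eq_dsum => a b.
  rewrite (@partial_eq_on _ _ U _ (fun y => partial b f y + partial b g y)) //; last first.
    by move=> y Uy; rewrite (smooth_partialD (U := U)).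
  have sfb := smooth_on_partial b sf; have sgb := smooth_on_partial b sg.
  by rewrite (smooth_partialD (U := U)) // mulrDr.
have L u : laplace G u x = dsum (fun a b => H x a b * partial a (partial b u) x)
    + \sum_c laplace_drift G c x * partial c u x by [].
by rewrite (L f) (L g) addrACA -E1 -E2.
Qed.

Lemma laplaceM f g x : smooth_on U f -> smooth_on U g -> U x ->
  laplace G (fun y => f y * g y) x = laplace G f x * g x + f x * laplace G g x
    + 2 * \sum_a \sum_b H x a b * partial a f x * partial b g x.
Proof.
move=> sf sg Ux.
have E : \sum_a \sum_b H x a b * partial a (partial b (fun y => f y * g y)) x =
    dsum (fun a b => H x a b * partial a (partial b f) x) * g x
    + f x * dsum (fun a b => H x a b * partial a (partial b g) x)
    + 2 * dsum (fun a b => H x a b * partial a f x * partial b g x).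
  have -> : 2 * dsum (fun a b => H x a b * partial a f x * partial b g x)
    = dsum (fun a b => H x a b * partial b f x * partial a g x)
      + dsum (fun a b => H x a b * partial a f x * partial b g x).
    have -> : dsum (fun a b => H x a b * partial b f x * partial a g x)
       = dsum (fun a b => H x a b * partial a f x * partial b g x).
      by rewrite dsumC; apply: eq_dsum => a b; rewrite (ginv_sym symG b a Ux).
    ring.
  rewrite [_ * g x]mulrC -!dsumZ -!dsumD; apply: eq_dsum => a b.
  rewrite (@partial_eq_on _ _ U _
    (fun y => partial b f y * g y + f y * partial b g y)) //; last first.
    by move=> y Uy; rewrite (smooth_partialM (U := U)).
  have sfb := smooth_on_partial b sf; have sgb := smooth_on_partial b sg.
  rewrite (smooth_partialD (U := U)) //; try exact: smooth_onM.
  rewrite !(smooth_partialM (U := U)) //.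
  have alg (h p q r t u v w z : R) : h * (p * q + r * t + (u * v + w * z)) =
     q * (h * p) + w * (h * z) + (h * r * t + h * u * v) by ring.
  exact: alg.
have E1 : \sum_c laplace_drift G c x * partial c (fun y => f y * g y) x =
    (\sum_c laplace_drift G c x * partial c f x) * g x
    + f x * \sum_c laplace_drift G c x * partial c g x.
  rewrite mulr_suml mulr_sumr -big_split; apply: eq_bigr => c _ /=.
  by rewrite (smooth_partialM (U := U)) //; ring.
have L u : laplace G u x = dsum (fun a b => H x a b * partial a (partial b u) x)
    + \sum_c laplace_drift G c x * partial c u x by [].
have alg (p q r t u v k : R) : p * u + v * q + k + (r * u + v * t) =
    (p + r) * u + v * (q + t) + k by ring.
rewrite (L f) (L g) -alg -E1 -E; exact: L.
Qed.

End Operators.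

(** * The intertwining relation on linear and quadratic functions *)

Section CenteredCoordinate.
Context {R : realType} {n : nat}.

(** The c-th coordinate, shifted to vanish at [x0]. *)
Definition centered_coord (x0 : 'rV[R]_n) (c : 'I_n) : 'rV[R]_n -> R :=
  fun y => y 0 c - x0 0 c.

Lemma centered_coord0 x0 c : centered_coord x0 c x0 = 0.
Proof. exact: subrr. Qed.

Lemma smooth_centered_coord U x0 c : open U -> smooth_on U (centered_coord x0 c).
Proof.
move=> oU; apply: smooth_onD; [exact: oU|exact: smooth_on_coord|exact: smooth_on_cst].
Qed.

Lemma partial_centered_coord a x0 c :
  partial a (centered_coord x0 c) = (fun=> (c == a)%:R).
Proof.
apply/funext => x; rewrite /centered_coord.
rewrite (@smooth_partialB _ _ setT (fun y => y 0 c) (fun=> x0 0 c)) //; last 2 first.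
- exact: smooth_on_coord.
- exact: smooth_on_cst.
by rewrite partial_coord partial_cst subr0.
Qed.

End CenteredCoordinate.

Section Tests.
Context {R : realType} {n : nat} {U : set 'rV[R]_n} {G : 'rV[R]_n -> 'M[R]_n}.
Hypotheses (oU : open U) (sG : forall a b, smooth_on U (fun x => G x a b)).
Hypotheses (symG : forall x, U x -> (G x)^T = G x).
Hypotheses (uG : forall x, U x -> G x \in unitmx).
Context {s : 'rV[R]_n -> 'rV[R]_n}.
Hypothesis (ss : forall a, smooth_on U (fun x => s x 0 a)).
Local Notation H := (ginv G).
Local Notation S := (raise G s).
Local Notation phi := (divergence G s).
Local Notation W := (yamabe_potential G).
Hypothesis ck : forall x, U x -> forall a b,
  2^-1 * (nabla G s a b x + nabla G s b a x) - n%:R^-1 * phi x * G x a b = 0.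
Let sH := smooth_ginv oU sG uG.
Let sS := smooth_raise oU sG uG ss.
Let sphi := smooth_divergence oU sG symG uG ss.
Let sW := smooth_yamabe_potential oU sG uG.
Let sdrift := smooth_laplace_drift oU sG uG.
Let sy x0 c := smooth_centered_coord x0 c oU.
Variables (A B : R) (x0 : 'rV[R]_n) (c : 'I_n).
Hypothesis Ux0 : U x0.
Local Notation yc := (centered_coord x0 c).

Lemma laplace_centered_coord x : U x -> laplace G yc x = laplace_drift G c x.
Proof.
move=> Ux; rewrite /laplace big1 ?add0r => [|a _].
  by under eq_bigr do rewrite partial_centered_coord; exact: sum_delta.
by apply: big1 => b _; rewrite partial_centered_coord partial_cst mulr0.
Qed.

(** The intertwining relation at [x0] on a coordinate function. *)
Lemma linear_test :
  yamabe G (first_order_op G s A yc) x0 = first_order_op G s B (yamabe G yc) x0 ->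
  (2 * A - 1 + 2 / n%:R) * \sum_a H x0 a c * partial a phi x0
  = (B - A - 2 / n%:R) * phi x0 * laplace_drift G c x0.
Proof.
have sAphi : smooth_on U (fun y => A * phi y).
  by apply: smooth_onM => //; exact: smooth_on_cst.
have EL x : U x -> first_order_op G s A yc x = S x c + A * phi x * yc x.
  move=> Ux; rewrite /first_order_op -(sum_delta (raise G s x) c).
  by under eq_bigr do rewrite partial_centered_coord.
have ER x : U x -> yamabe G yc x = - laplace_drift G c x + W x * yc x.
  by move=> Ux; rewrite (yamabeE oU sG symG uG) // laplace_centered_coord.
rewrite (yamabe_eq_on oU sG symG uG oU (@subset_refl _ U) EL Ux0).
rewrite (first_order_op_eq_on s B oU ER Ux0).
rewrite (yamabeE oU sG symG uG) // centered_coord0 mulr0 addr0.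
rewrite (laplaceD (U := U) oU) //; last exact: smooth_onM.
rewrite (laplaceM oU symG) // laplace_centered_coord // centered_coord0 mulr0 add0r.
have -> : \sum_a \sum_b H x0 a b * partial a (fun y => A * phi y) x0 * partial b yc x0
    = A * \sum_a H x0 a c * partial a phi x0.
  rewrite mulr_sumr; apply: eq_bigr => a _.
  rewrite partial_cstM; last exact: smooth_on_derivable Ux0.
  under eq_bigr do rewrite partial_centered_coord.
  by rewrite (sum_delta (fun b => H x0 a b * (A * partial a phi x0))); ring.
rewrite /first_order_op centered_coord0 mulr0 addr0.
have -> : \sum_a S x0 a * partial a (fun y => - laplace_drift G c y + W y * yc y) x0
   = - \sum_a S x0 a * partial a (laplace_drift G c) x0 + W x0 * S x0 c.
  rewrite -(sum_delta (raise G s x0) c) mulr_sumr -sumrN -big_split; apply: eq_bigr => a _ /=.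
  rewrite (smooth_partialD (U := U)) //; [|exact: smooth_onN|exact: smooth_onM].
  rewrite (smooth_partialM (U := U)) // partial_centered_coord centered_coord0.
  rewrite partialN; last exact: smooth_on_derivable Ux0.
  ring.
have := laplace_commutator oU sG symG uG ss ck c Ux0.
have -> : \sum_a H x0 a c * (partial a phi x0 - partial a (fun x => 2 / n%:R * phi x) x0)
   = (1 - 2 / n%:R) * \sum_a H x0 a c * partial a phi x0.
  rewrite mulr_sumr; apply: eq_bigr => a _.
  rewrite partial_cstM; last exact: smooth_on_derivable Ux0.
  ring.
have alg (SD L K D p w k : R) : SD - L = (1 - k) * K - k * p * D ->
    - (L + (A * p * D + 2 * (A * K))) + w = - SD + w + B * p * - D ->
    (2 * A - 1 + k) * K = (B - A - k) * p * D by lra.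
exact: alg.
Qed.

(** The intertwining relation at [x0] on the square of a coordinate function, which
    detects the second order terms. *)
Lemma quadratic_test :
  yamabe G (first_order_op G s A (fun y => yc y * yc y)) x0
    = first_order_op G s B (yamabe G (fun y => yc y * yc y)) x0 ->
  (B - A - 2 / n%:R) * phi x0 * H x0 c c = 0.
Proof.
pose F y := yc y * yc y.
have syc := sy x0 c.
have sF : smooth_on U F by exact: smooth_onM.
have sAphi : smooth_on U (fun y => A * phi y).
  by apply: smooth_onM => //; exact: smooth_on_cst.
have s2S : smooth_on U (fun y => 2 * S y c).
  by apply: smooth_onM => //; exact: smooth_on_cst.
have pF a x : U x -> partial a F x = 2 * yc x * (c == a)%:R.
  move=> Ux; rewrite (smooth_partialM (U := U)) // partial_centered_coord; ring.
have lF x : U x -> laplace G F x = 2 * laplace_drift G c x * yc x + 2 * H x c c.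
  move=> Ux; rewrite (laplaceM oU symG) // laplace_centered_coord //.
  have -> : \sum_a \sum_b H x a b * partial a yc x * partial b yc x = H x c c.
    rewrite -(sum_delta (fun a => H x a c) c); apply: eq_bigr => a _.
    under eq_bigr do rewrite !partial_centered_coord.
    by rewrite (sum_delta (fun b => H x a b * (c == a)%:R)).
  ring.
have EL x : U x -> first_order_op G s A F x = 2 * S x c * yc x + A * phi x * F x.
  move=> Ux; rewrite /first_order_op; congr (_ + _).
  transitivity (\sum_a (2 * S x a * yc x) * (c == a)%:R); last exact: sum_delta.
  by apply: eq_bigr => a _; rewrite pF //; ring.
have ER x : U x -> yamabe G F x =
    - (2 * laplace_drift G c x * yc x + 2 * H x c c) + W x * F x.
  by move=> Ux; rewrite (yamabeE oU sG symG uG) // lF.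
have F0 : F x0 = 0 by rewrite /F centered_coord0 mulr0.
rewrite (yamabe_eq_on oU sG symG uG oU (@subset_refl _ U) EL Ux0).
rewrite (first_order_op_eq_on s B oU ER Ux0).
rewrite (yamabeE oU sG symG uG) // F0 centered_coord0 !mulr0 !addr0 mulr0 addr0.
rewrite (laplaceD (U := U) oU) //; [|exact: smooth_onM|exact: smooth_onM].
rewrite [laplace G (fun y => 2 * S y c * yc y) x0](laplaceM oU symG) // laplace_centered_coord //.
rewrite [laplace G (fun y => A * phi y * F y) x0](laplaceM oU symG) // lF // F0 centered_coord0.
have -> : \sum_a \sum_b H x0 a b * partial a (fun y => 2 * S y c) x0 * partial b yc x0
    = 2 * \sum_a H x0 a c * partial a (fun y => S y c) x0.
  rewrite mulr_sumr; apply: eq_bigr => a _.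
  rewrite partial_cstM; last exact: smooth_on_derivable Ux0.
  under eq_bigr do rewrite partial_centered_coord.
  by rewrite (sum_delta (fun b => H x0 a b * (2 * partial a (fun y => S y c) x0))); ring.
have -> : \sum_a \sum_b H x0 a b * partial a (fun y => A * phi y) x0 * partial b F x0 = 0.
  apply: big1 => a _; apply: big1 => b _.
  by rewrite pF // centered_coord0 !(mulr0, mul0r).
rewrite /first_order_op F0 centered_coord0.
have -> : \sum_a S x0 a * partial a (fun y =>
     - (2 * laplace_drift G c y * yc y + 2 * H y c c) + W y * F y) x0
   = - 2 * (S x0 c * laplace_drift G c x0)
     - 2 * \sum_a S x0 a * partial a (fun y => H y c c) x0.
  rewrite -(sum_delta (fun a => S x0 a * laplace_drift G c x0) c) !mulr_sumr -sumrB.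
  apply: eq_bigr => a _.
  have s2d : smooth_on U (fun y => 2 * laplace_drift G c y).
    by apply: smooth_onM => //; exact: smooth_on_cst.
  have s2H : smooth_on U (fun y => 2 * H y c c).
    by apply: smooth_onM => //; exact: smooth_on_cst.
  have s2dy : smooth_on U (fun y => 2 * laplace_drift G c y * yc y) by exact: smooth_onM.
  have sN : smooth_on U (fun y => 2 * laplace_drift G c y * yc y + 2 * H y c c).
    exact: smooth_onD.
  rewrite (smooth_partialD (U := U)) //; [|exact: smooth_onN|exact: smooth_onM].
  rewrite [partial a (fun y => W y * F y) x0](smooth_partialM (U := U)) // F0 pF // centered_coord0.
  rewrite partialN; last exact: smooth_on_derivable Ux0.
  rewrite (smooth_partialD (U := U)) // (smooth_partialM (U := U)) //.
  rewrite partial_centered_coord centered_coord0.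
  rewrite [partial a (fun y => 2 * H y c c) x0]partial_cstM; last exact: smooth_on_derivable Ux0.
  ring.
have := conformal_killing_inverse oU sG symG uG ss ck c c Ux0.
have -> : \sum_e (H x0 e c * partial e (fun y => S y c) x0
      + H x0 c e * partial e (fun y => S y c) x0)
   = 2 * \sum_a H x0 a c * partial a (fun y => S y c) x0.
  rewrite mulr_sumr; apply: eq_bigr => e _.
  by rewrite (ginv_sym symG c e Ux0); ring.
move: (\sum_a S x0 a * _) (\sum_a H x0 a c * _) => T K.
move: (H x0 c c) (phi x0) (laplace_drift G c x0) (S x0 c) => h p D Sc.
lra.
Qed.

End Tests.

(** * Conclusion *)

Section Metric.
Context (R : realType) (n : nat) (M : topologicalType) (X : smooth_manifold R n M).
Context (g : riemannian_metric X).

Lemma metric_unitmx i x : img i x -> metric g i x \in unitmx.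
Proof.
move=> Ix; rewrite -row_free_unit -kermx_eq0; apply/negPn/negP => /rowV0Pn [v].
move=> /sub_kermxP vG v0; have := metric_posdef g Ix v0.
by rewrite vG mul0mx mxE ltxx.
Qed.

Lemma ginv_diag_gt0 i x c : img i x -> 0 < ginv (metric g i) x c c.
Proof.
move=> Ix; have uG := metric_unitmx Ix; pose v := row c (ginv (metric g i) x).
have vG : v *m metric g i x = delta_mx 0 c by rewrite -row_mul mulVmx // row1.
have v0 : v != 0.
  apply/eqP => v0; have := congr1 (fun A : 'rV_n => A 0 c) vG.
  by rewrite v0 mul0mx !mxE !eqxx => /esym/eqP; rewrite oner_eq0.
have := metric_posdef g Ix v0; rewrite vG -rowE.
by rewrite !mxE.
Qed.

End Metric.

Theorem theorem1 (R : realType) (n : nat) (n_ge3 : (3 <= n)%N)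
  (M : topologicalType) (X : smooth_manifold R n M) (g : riemannian_metric X)
  (s : one_form X) (A B : R) :
  conformal_killing g s ->
  divergence_not_locally_constant g s ->
  (forall f : M -> R, smooth_function X f -> yamabe_intertwining g s A B f) ->
  A = (n%:R - 2) / (2 * n%:R) /\ B = (n%:R + 2) / (2 * n%:R).
Proof.
move=> ck [i [x1 [Ix1 dphi]]] intertwining.
have oU := @open_img R n M X i.
have sG := metric_smooth g i; have symG := @metric_sym _ _ _ _ g i.
have uG := @metric_unitmx _ _ _ _ g i.
have ss := @form_smooth _ _ _ _ s i; have {}ck := ck i.
have n0 : (0 < n)%N by exact: leq_trans n_ge3.
have nR0 : (n%:R : R) != 0 by rewrite pnatr_eq0 -lt0n.
set phi := divergence (metric g i) (form s i) in dphi.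
(* By locality the relation holds at x for functions of the coordinates. *)
have local_intertwining x F : img i x -> smooth_on setT F ->
    yamabe (metric g i) (first_order_op (metric g i) (form s i) A F) x
    = first_order_op (metric g i) (form s i) B (yamabe (metric g i) F) x.
  move=> Ix sF; have [f [V [sf oV Vx VU fF]]] := extend_by_zero sF Ix.
  have E1 y (Vy : V y) := first_order_op_eq_on (G := metric g i) (form s i) A oV fF Vy.
  have E2 y (Vy : V y) := yamabe_eq_on oU sG symG uG oV VU fF Vy.
  rewrite -(yamabe_eq_on oU sG symG uG oV VU E1 Vx).
  rewrite -(first_order_op_eq_on (G := metric g i) (form s i) B oV E2 Vx).
  exact: intertwining.
have BA : B = A + 2 / n%:R.
  have [x2 [Ix2 phi2]] : exists x2, img i x2 /\ phi x2 != 0.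
    apply: contrapT => /forallNP nphi; move/eqP: dphi; apply.
    apply/rowP => a; rewrite [RHS]mxE mxE.
    have phi0 y : img i y -> phi y = 0.
      by move=> Iy; apply/eqP; apply: contrapT => /negP py; apply: (nphi y).
    by rewrite (partial_eq_on a oU phi0 Ix1) partial_cst.
  pose c := Ordinal n0.
  have sF : smooth_on setT (fun y => centered_coord x2 c y * centered_coord x2 c y).
    by apply: smooth_onM; [exact: openT|exact: smooth_centered_coord openT..].
  have := quadratic_test oU sG symG uG ss ck Ix2 (local_intertwining _ _ Ix2 sF).
  rewrite -/phi => /eqP; rewrite mulf_eq0 (gt_eqF (ginv_diag_gt0 g c Ix2)) orbF.
  rewrite mulf_eq0 (negPf phi2) orbF => /eqP E.
  by apply/eqP; rewrite -subr_eq0 -E; apply/eqP; ring.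
pose K c := \sum_a ginv (metric g i) x1 a c * partial a phi x1.
have [c Kc] : exists c, K c != 0.
  apply: contrapT => /forallNP K0; move/eqP: dphi; apply.
  have dH0 : differential phi x1 *m ginv (metric g i) x1 = 0.
    apply/rowP => c; rewrite [RHS]mxE mxE.
    transitivity (K c); first by apply: eq_bigr => a _; rewrite mxE mulrC.
    by apply/eqP; apply: contrapT => /negP; exact: K0.
  by rewrite -(mulmxKV (uG _ Ix1) (differential phi x1)) dH0 mul0mx.
have sF : smooth_on setT (centered_coord x1 c) by exact: smooth_centered_coord openT.
have := linear_test oU sG symG uG ss ck Ix1 (local_intertwining _ _ Ix1 sF).
rewrite BA -/phi [X in X * _ * _](_ : _ = 0); last by ring.
rewrite !mul0r => /eqP; rewrite mulf_eq0 (negPf Kc) orbF => /eqP E.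
have {}E : A = (n%:R - 2) / (2 * n%:R).
  have -> : A = 2^-1 * ((2 * A - 1 + 2 / n%:R) + 1 - 2 / n%:R) by field.
  by rewrite E; field.
by split=> //; rewrite E; field.
Qed.
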